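(* Let $Q$ be a polygon, $\nu$ an $S$-invariant measure on $P_Q$, $f: \mathbb{N} \to \mathbb{N}$ a monotonically increasing unbounded function, and $K_0>0$ a constant. There is a non-increasing sequence $(a_n)$ of positive real numbers which satisfies $\nu(B_{a_n}) < \frac{K_0}{n f(n)}$ for all $n\ge 1$. For any such sequence there is a set $G$ of full $\nu$-measure which is a dense $G_\delta$-subset of $\operatorname{supp}(\nu)$ with the property that for every $z \in G$ there exists an infinite strictly increasing sequence $n_i$ such that $$B\left (z,\frac{a_{n_i}}{2 + n_i \cdot \operatorname{diam}(Q)} \right ) \subset C_{n_i}(z).$$
   Context: A polygon $Q$ is a planar polygon (not assumed convex). The billiard flow $\phi_t$ in $Q$ is the free motion of a point particle with unit speed and specular reflections from the boundary; reflections are not defined at corners. Its phase space $\mathcal{P}_Q$ is the set of all inner pointing unit vectors $(x,\psi)$, $x\in Q$, $\psi\in[0,2\pi)$, with the metric $\rho((x,\psi),(x',\psi')) = \|x-x'\|_2+|\psi-\psi'|$. The boundary $\partial\mathcal{P}_Q$ consists of the vectors tangent to a side of $Q$ and the vectors whose foot point is a vertex of $Q$. The billiard map $S$ is the first return map of the billiard flow to $\partial Q$; it is not defined for points for which the next arrival to the boundary is a vertex. Its phase space $P_Q$ is the set of inward pointing unit vectors with foot point in $\partial Q$, written $z=(s,\theta)$, where $s$ is the foot point in the arc length parametrization of $\partial Q$ and $\theta$ is the angle with the positive direction of the boundary. $P_Q$ carries the $L_1$ metric $d((s,\theta),(s',\theta'))=|s-s'|+|\theta-\theta'|$, and $B(z,\varepsilon)$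 is the $L_1$-ball in $P_Q$ centered at $z$ of radius $\varepsilon$. An $S$-invariant measure is a finite Borel measure on $P_Q$, invariant under $S$, which is supported on the set of non-singular points (those whose orbits never meet a vertex); in particular it gives measure zero to the boundary of the phase space and to the set of points at which $S$ is not defined. For $z\in P_Q$ let $t(z)$ be the geometric length of the orbit segment between $z$ and $S(z)$. For $a>0$ let $$B_a := \{z\in P_Q: \phi_t(z)\in B(\partial\mathcal{P}_Q,a) \text{ for some } t\in[0,t(z)]\},$$ where $B(\partial\mathcal{P}_Q,a)$ is the $a$-neighborhood of $\partial\mathcal{P}_Q$ with respect to $\rho$. Label the sides of $Q$ by distinct letters of a finite alphabet and code each forward orbit by the sequence of sides it hits. For $z\in P_Q$ such that $S^n(z)$ is defined, the $n$-cell $C_n(z)$ is the open set of points for which $S^n$ is defined and whose coding sequence up to time $n$ coincides with that of $z$; equivalently, it is the largest open set containing $z$ on which $S^n$ is continuous. *)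

(* Defs.v *)
From HB Require Import structures.
From mathcomp Require Import all_boot all_order all_algebra.
From mathcomp Require Import all_classical all_reals all_analysis borel_hierarchy.

Set Implicit Arguments.
Unset Strict Implicit.
Unset Printing Implicit Defensive.

Import Order.TTheory GRing.Theory Num.Theory.
Import numFieldNormedType.Exports.

Local Open Scope classical_set_scope.
Local Open Scope ring_scope.

(* The norm MathComp-Analysis puts on a product is the max norm, hence [enorm];
   both induce the product topology, which is the one used on [R * R]. *)
Definition dotp (R : realType) (u v : R * R) : R := u.1 * v.1 + u.2 * v.2.

Definition enorm (R : realType) (u : R * R) : R := Num.sqrt (dotp u u).

Definition unit_vec (R : realType) (psi : R) : R * R := (cos psi, sin psi).

Definition rotate (R : realType) (theta : R) (u : R * R) : R * R :=
  (cos theta * u.1 - sin theta * u.2, sin theta * u.1 + cos theta * u.2).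

(* Reflection in the line spanned by the unit vector [e]. *)
Definition reflect_along (R : realType) (e u : R * R) : R * R :=
  (2 * dotp u e) *: e - u.

Definition seg (R : realType) (x y : R * R) : set (R * R) :=
  [set x + t *: (y - x) | t in [set t : R | 0 <= t <= 1]].

Definition unit_dir (R : realType) (x y : R * R) : R * R :=
  (enorm (y - x))^-1 *: (y - x).

(* A polygon is the closed region bounded by a simple closed polygonal curve.
   The vertices are listed cyclically ([ordS] is the cyclic successor), in the
   order for which the region lies to the left of each side; this fixes the
   positive direction of the boundary, and together with compactness and
   [poly_boundary] it identifies the region as the curve plus its inside. *)
Record polygon (R : realType) := Polygon {
  nsides : nat;
  vertex : 'I_nsides -> R * R;
  region : set (R * R);
  poly_nsides : (2 < nsides)%N;
  poly_vertex_inj : injective vertex;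
  poly_simple : forall (i j : 'I_nsides) (x : R * R), i != j ->
    seg (vertex i) (vertex (ordS i)) x -> seg (vertex j) (vertex (ordS j)) x ->
    (j = ordS i /\ x = vertex j) \/ (i = ordS j /\ x = vertex i);
  poly_compact : compact region;
  poly_boundary : closure region `\` interior region =
    \bigcup_(i in [set: 'I_nsides]) seg (vertex i) (vertex (ordS i));
  poly_left : forall (i : 'I_nsides) (t : R), 0 < t < 1 ->
    exists2 eps : R, 0 < eps & forall h : R, 0 < h < eps ->
      region (vertex i + t *: (vertex (ordS i) - vertex i)
              + h *: rotate (pi / 2) (unit_dir (vertex i) (vertex (ordS i)))) }.

Section Geometry.
Context (R : realType) (Q : polygon R).

Definition side (i : 'I_(nsides Q)) : set (R * R) :=
  seg (vertex i) (vertex (ordS i)).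

Definition bdry : set (R * R) := closure (region Q) `\` interior (region Q).

Definition side_len (i : 'I_(nsides Q)) : R :=
  enorm (vertex (ordS i) - vertex i).

Definition side_dir (i : 'I_(nsides Q)) : R * R :=
  unit_dir (vertex i) (vertex (ordS i)).

Definition diam : R :=
  sup [set d | exists x y, [/\ region Q x, region Q y & d = enorm (x - y)]].

Definition side_start (i : 'I_(nsides Q)) : R :=
  \sum_(k < nsides Q | (k < i)%N) side_len k.

(* [arc_point i s] is the boundary point with arc length parameter [s] when [s]
   is in [[side_start i, side_start i + side_len i[]. *)
Definition arc_point (i : 'I_(nsides Q)) (s : R) : R * R :=
  vertex i + (s - side_start i) *: side_dir i.

Definition in_open_side (i : 'I_(nsides Q)) (s : R) : Prop :=
  side_start i < s < side_start i + side_len i.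

(* A pair [p = (x, psi)] stands for the unit vector of direction [psi] and foot
   point [x]; a pair [z = (s, theta)] for arc length coordinates.
   [vector_at z p]: the coordinates [z] describe the vector [p]. The angle at a
   vertex is measured from the side starting there. *)
Definition vector_at (z : R * R) (p : (R * R) * R) : Prop :=
  0 <= p.2 < 2 * pi /\
  exists i : 'I_(nsides Q),
    [/\ side_start i <= z.1 < side_start i + side_len i,
        p.1 = arc_point i z.1
      & unit_vec p.2 = rotate z.2 (side_dir i)].

Definition inward (p : (R * R) * R) : Prop :=
  exists2 eps : R, 0 < eps &
    forall t : R, 0 < t < eps -> region Q (p.1 + t *: unit_vec p.2).

(* Vectors tangent to a side are included. *)
Definition phase_space : set (R * R) :=
  [set z | 0 <= z.2 < 2 * pi /\ exists2 p, vector_at z p & inward p].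

Definition phase_ball (z : R * R) (eps : R) : set (R * R) :=
  [set z' | phase_space z' /\ `|z.1 - z'.1| + `|z.2 - z'.2| < eps].

(* Graph of the billiard map: [billiard_step z tau z'] means that S z is defined
   and equal to [z'], and that tau = t(z). Since reflections are not defined at
   corners, both foot points lie in open sides. *)
Definition billiard_step (z : R * R) (tau : R) (z' : R * R) : Prop :=
  [/\ phase_space z, phase_space z', 0 < tau &
  exists i j p p',
    [/\ in_open_side i z.1 /\ in_open_side j z'.1,
        vector_at z p /\ vector_at z' p',
        p'.1 = p.1 + tau *: unit_vec p.2,
        forall t : R, 0 < t < tau -> ~ bdry (p.1 + t *: unit_vec p.2)
      & unit_vec p'.2 = reflect_along (side_dir j) (unit_vec p.2)]].

Fixpoint billiard_iter (n : nat) (z z' : R * R) : Prop :=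
  if n is m.+1 then
    exists2 y, billiard_iter m z y & exists tau, billiard_step y tau z'
  else phase_space z /\ z' = z.

(* phi_t(z) for t in [0, t(z)]; the vector is already reflected at t = t(z). *)
Definition flow (z : R * R) (t : R) (q : (R * R) * R) : Prop :=
  exists tau z' p,
    [/\ billiard_step z tau z', vector_at z p &
    (0 <= t < tau /\ q = (p.1 + t *: unit_vec p.2, p.2)) \/
    (t = tau /\ vector_at z' q)].

(* The boundary of the phase space of the flow. *)
Definition flow_bdry : set ((R * R) * R) :=
  [set q | 0 <= q.2 < 2 * pi /\
    ((exists i, q.1 = vertex (p := Q) i) \/
     (exists2 i, side i q.1 &
        unit_vec q.2 = side_dir i \/ unit_vec q.2 = - side_dir i))].

Definition rho (q q' : (R * R) * R) : R :=
  enorm (q.1 - q'.1) + `|q.2 - q'.2|.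

(* B_a *)
Definition near_singular (a : R) : set (R * R) :=
  [set z | phase_space z /\
    exists t q q', [/\ flow z t q, flow_bdry q' & rho q q' < a]].

Definition nonsingular : set (R * R) :=
  [set z | forall n, exists z', billiard_iter n z z'].

(* C_n(z): codes are compared at the times 0, ..., n. *)
Definition cell (n : nat) (z : R * R) : set (R * R) :=
  [set z' | forall k, (k <= n)%N -> exists y y' i,
    [/\ billiard_iter k z y, billiard_iter k z' y',
        in_open_side i y.1 & in_open_side i y'.1]].

(* Measures on the phase space are finite Borel measures on the plane of the
   coordinates (s, theta) that are concentrated on [nonsingular], a subset of
   [phase_space]. *)
Definition billiard_invariant
    (nu : {finite_measure set (measurableTypeR R * measurableTypeR R)%type
           -> \bar R}) : Prop :=
  nu.-negligible (~` nonsingular) /\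
  forall A : set (measurableTypeR R * measurableTypeR R), measurable A ->
    nu [set z | exists tau z', billiard_step z tau z' /\ A z'] = nu A.

Definition supp
    (nu : {finite_measure set (measurableTypeR R * measurableTypeR R)%type
           -> \bar R}) : set (R * R) :=
  [set z | phase_space z /\
    forall U : set (R * R), open U -> U z -> (0 < nu U)%E].

(* In [\bar R] the bound is +oo when [f n = 0]. The value [a 0] is irrelevant. *)
Definition admissible
    (nu : {finite_measure set (measurableTypeR R * measurableTypeR R)%type
           -> \bar R}) (f : nat -> nat) (K0 : R) (a : nat -> R) : Prop :=
  [/\ forall n, (0 < n)%N -> 0 < a n,
      forall m n, (0 < m <= n)%N -> a n <= a m
    & forall n, (0 < n)%N ->
        (nu (near_singular (a n)) < K0%:E / ((n * f n)%:R)%:E)%E].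

End Geometry.

(* Main.v *)
Require Import Defs.
From HB Require Import structures.
From mathcomp Require Import all_boot all_order all_algebra.
From mathcomp Require Import all_classical all_reals all_analysis borel_hierarchy.
From mathcomp Require Import measurable_realfun ring lra.
Import Order.TTheory GRing.Theory Num.Theory.
Import numFieldNormedType.Exports.
Local Open Scope classical_set_scope.
Local Open Scope ring_scope.

Set Implicit Arguments.
Unset Strict Implicit.
Unset Printing Implicit Defensive.

(** Suppose that the flow line of [z0] stays at distance at least [a] from every
vertex up to time [T]. Then every vector [z1] launched from the same side with
[`|ds| + T * `|dtheta| < a], where [ds] and [dtheta] are the differences of the
coordinates, hits the same sides as [z0] as long as both reflect before time [T]
([perturbation_alive], [same_itinerary]). To see this, join [z0] to [z1] by a
straight path [z_l] and look at the position [X_l t] at a fixed time [t]. As [l]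
varies the position moves continuously, and it is locally the image, under a
composition of reflections, of the point reached at time [t] by the free motion
from [z_l]; hence it moves by at most [`|ds| + t * `|dtheta| < a]
([flow_lipschitz]). A trajectory of the family that were the first to run into a
vertex, at time [t], would bring that vertex within [a] of [X_0 t], which is
excluded. Without vertices on the way, the sequence of the first [n] sides is
locally constant in [l], hence constant. Since a flight is no longer than
[diam Q], [n] reflections take place before [T = 1 + n * diam Q], and for this
[T] the condition on [z1] holds on the ball of radius [a / (1 + n * diam Q)].

Positions have to be compared at equal times, and the reflections of the two
trajectories may be shifted against each other: [z1] may be about to hit its
[n]-th side when [z0] has already reflected many more times. So the vertices must
be avoided during the whole time [T], and the number of flights of [z0] up to time
[T] has no bound in terms of [n] that would hold for all [z0]. The invariant
measure supplies one outside a small set ([measure_not_clear_small]). Let [delta]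
be such that flights shorter than [delta] have small measure, and let
[g * delta > 1 + diam Q]. By Markov's inequality ([count_markov]), outside a set
of measure [2 * nu (short_flight Q delta)] at least half of the first [2 * g * n]
flights are longer than [delta], so that these flights last longer than [T]. The
set of the vectors that visit [near_singular Q (a n)] during these flights has
measure at most [2 * g * n * (K0 / (n * f n))], which tends to [0].

Consequently the lower limit of the measure of the exceptional sets is [0], and
almost every vector is good for infinitely many [n]. The radius of the theorem is
smaller than [a / (1 + n * diam Q)], which leaves room to replace the good vectors
by an open set ([itin_ball]); the upper limit of these open sets is a [G_delta] set
of full measure ([full_measure_limsup]), and a set of full measure is dense in the
support.

A sequence [a] exists because the sets [near_singular Q a] are Borel
([measurable_near_singular]) and decrease to the empty set with [a]
([near_singular_vanish]). *)

(** * Euclidean geometry of the plane *)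

Section Plane.
Context (R : realType).
Implicit Types (u v w p : R * R) (t : R).

Lemma dotpC u v : dotp u v = dotp v u.
Proof. by rewrite /dotp; ring. Qed.

Lemma dotpDl u v w : dotp (u + v) w = dotp u w + dotp v w.
Proof. by rewrite /dotp /=; ring. Qed.

Lemma dotpBl u v w : dotp (u - v) w = dotp u w - dotp v w.
Proof. by rewrite /dotp /=; ring. Qed.

Lemma dotpZl t u w : dotp (t *: u) w = t * dotp u w.
Proof. by rewrite /dotp /= /GRing.scale /=; ring. Qed.

Lemma dotp_ge0 u : 0 <= dotp u u.
Proof. by rewrite /dotp addr_ge0 // -expr2 sqr_ge0. Qed.

Lemma enorm_ge0 u : 0 <= enorm u.
Proof. exact: sqrtr_ge0. Qed.

Lemma enorm_sqr u : enorm u ^+ 2 = dotp u u.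
Proof. by rewrite sqr_sqrtr // dotp_ge0. Qed.

Lemma enorm_le u c : 0 <= c -> dotp u u <= c ^+ 2 -> enorm u <= c.
Proof.
move=> c0 h; rewrite -(ler_pXn2r (n := 2)) ?nnegrE ?enorm_ge0 //.
by rewrite enorm_sqr.
Qed.

Lemma le_enorm u c : 0 <= c -> c ^+ 2 <= dotp u u -> c <= enorm u.
Proof.
move=> c0 h; rewrite -(ler_pXn2r (n := 2)) ?nnegrE ?enorm_ge0 //.
by rewrite enorm_sqr.
Qed.

Lemma dotp_le u v : dotp u v <= enorm u * enorm v.
Proof.
have := enorm_ge0 u; have := enorm_ge0 v.
have [/ltW h _ _|h] := ltrP (dotp u v) 0.
  by rewrite (le_trans h) // mulr_ge0 ?enorm_ge0.
move=> hv hu.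
rewrite -(ler_pXn2r (n := 2)) ?nnegrE ?mulr_ge0 // exprMn !enorm_sqr.
have := sqr_ge0 (u.1 * v.2 - u.2 * v.1).
rewrite /dotp; nra.
Qed.

Lemma enormD u v : enorm (u + v) <= enorm u + enorm v.
Proof.
apply: enorm_le; first by rewrite addr_ge0 ?enorm_ge0.
rewrite sqrrD !enorm_sqr.
have := dotp_le u v.
rewrite /dotp /=; lra.
Qed.

Lemma enormN u : enorm (- u) = enorm u.
Proof. by rewrite /enorm /dotp /= !mulrNN. Qed.

Lemma enormBC u v : enorm (u - v) = enorm (v - u).
Proof. by rewrite -enormN opprB. Qed.

Lemma enormZ t u : enorm (t *: u) = `|t| * enorm u.
Proof.
rewrite /enorm (_ : dotp _ _ = t ^+ 2 * dotp u u).
  by rewrite sqrtrM ?sqr_ge0 // sqrtr_sqr.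
by rewrite /dotp /= /GRing.scale /=; ring.
Qed.

Lemma enorm0 : enorm (0 : R * R) = 0.
Proof. by rewrite /enorm /dotp /= !mulr0 addr0 sqrtr0. Qed.

Lemma enorm_eq0 u : enorm u = 0 -> u = 0.
Proof.
move=> h; have := enorm_sqr u; rewrite h expr0n /= /dotp => /esym/eqP.
rewrite paddr_eq0 -?expr2 ?sqr_ge0 // !sqrf_eq0 => /andP[/eqP h1 /eqP h2].
by apply: injective_projections.
Qed.

Lemma enorm1P u : dotp u u = 1 -> enorm u = 1.
Proof. by rewrite /enorm => ->; rewrite sqrtr1. Qed.

Lemma enorm_lip u v w : enorm (u - w) <= enorm (u - v) + enorm (v - w).
Proof.
rewrite [X in enorm X <= _](_ : _ = (u - v) + (v - w)) ?enormD //.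
by rewrite addrA subrK.
Qed.

Definition perp u : R * R := (- u.2, u.1).

Lemma rotate_pihalf u : rotate (pi / 2) u = perp u.
Proof. by rewrite /rotate /perp cos_pihalf sin_pihalf; congr pair; ring. Qed.

Lemma dotp_perp u : dotp u (perp u) = 0.
Proof. by rewrite /dotp /perp /=; ring. Qed.

Lemma dotp_frame u v e : dotp e e = 1 ->
  dotp u v = dotp u e * dotp v e + dotp u (perp e) * dotp v (perp e).
Proof.
move=> he; rewrite -[LHS]mulr1 -he /dotp /perp /=; ring.
Qed.

Lemma frame u e : dotp e e = 1 ->
  u = dotp u e *: e + dotp u (perp e) *: perp e.
Proof.
rewrite /dotp /perp => he; apply: injective_projections;
  rewrite /= /GRing.scale /=.
- by rewrite -[LHS]mulr1 -he; ring.
- by rewrite -[LHS]mulr1 -he; ring.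
Qed.

Lemma frame_inj u v e : dotp e e = 1 -> dotp u e = dotp v e ->
  dotp u (perp e) = dotp v (perp e) -> u = v.
Proof. by move=> he h1 h2; rewrite (frame u he) (frame v he) h1 h2. Qed.

Lemma dotp_rotate t u : dotp (rotate t u) (rotate t u) = dotp u u.
Proof.
rewrite /rotate /dotp /= -[RHS]mul1r -(cos2Dsin2 t); ring.
Qed.

Lemma dotp_rotate_id t e : dotp e e = 1 -> dotp (rotate t e) e = cos t.
Proof. by move=> he; rewrite -[RHS]mulr1 -he /dotp /rotate /=; ring. Qed.

Lemma dotp_rotate_perp t e : dotp e e = 1 -> dotp (rotate t e) (perp e) = sin t.
Proof. by move=> he; rewrite -[RHS]mulr1 -he /dotp /rotate /perp /=; ring. Qed.

Lemma dotp_unit_vec t : dotp (unit_vec t) (unit_vec t) = 1.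
Proof. by rewrite /dotp /unit_vec /= -!expr2 cos2Dsin2. Qed.

Lemma rotate_unit_vec s t : rotate s (unit_vec t) = unit_vec (t + s).
Proof.
rewrite /rotate /unit_vec /= cosD sinD; congr pair; ring.
Qed.

Lemma sin_abs_le t : `|sin t| <= `|t|.
Proof.
suff H (x : R) : 0 <= x -> `|sin x| <= x.
  have [h|/ltW h] := leP 0 t; first by rewrite (ger0_norm h) H.
  by rewrite (ler0_norm h) -normrN -sinN H // oppr_ge0.
rewrite le_eqVlt => /orP[/eqP <-|x0]; first by rewrite sin0 normr0.
have ds (y : R) : y \in `]0, x[ -> is_derive y 1 sin (cos y).
  by move=> _; exact: is_derive_sin.
have cs : {within `[0, x], continuous (@sin R)}.
  exact/continuous_subspaceT/continuous_sin.
have [c _] := MVT x0 ds cs.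
rewrite sin0 !subr0 => ->; rewrite normrM (gtr0_norm x0).
by rewrite ler_piMl ?cos_max // ltW.
Qed.

(** A chord is at most as long as its arc: the chord of angle [x] has squared
length [4 * sin (x / 2) ^+ 2]. *)
Lemma rotate_lip s t e : dotp e e = 1 ->
  enorm (rotate s e - rotate t e) <= `|s - t|.
Proof.
move=> he; apply: enorm_le => //.
have -> : dotp (rotate s e - rotate t e) (rotate s e - rotate t e)
        = 2 - 2 * cos (s - t).
  rewrite cosB.
  transitivity (dotp e e * ((cos s ^+ 2 + sin s ^+ 2) + (cos t ^+ 2 + sin t ^+ 2)
    - 2 * (cos s * cos t + sin s * sin t))).
    by rewrite /dotp /rotate /=; ring.
  by rewrite he !cos2Dsin2; ring.
have -> : 2 - 2 * cos (s - t) = 4 * sin ((s - t) / 2) ^+ 2.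
  have -> : cos (s - t) = cos ((s - t) / 2 + (s - t) / 2) by congr cos; lra.
  rewrite cosD; have := cos2Dsin2 ((s - t) / 2); nra.
have : `|sin ((s - t) / 2)| ^+ 2 <= `|(s - t) / 2| ^+ 2.
  by rewrite ler_pXn2r ?nnegrE // sin_abs_le.
rewrite !real_normK ?num_real // => h2.
by nra.
Qed.

Lemma reflect_alongE e u : dotp e e = 1 ->
  reflect_along e u = u - (2 * dotp u (perp e)) *: perp e.
Proof.
move=> he; apply: (frame_inj he).
- by rewrite /reflect_along !dotpBl !dotpZl he (dotpC (perp e)) dotp_perp; ring.
- rewrite /reflect_along !dotpBl !dotpZl dotp_perp.
  have -> : dotp (perp e) (perp e) = dotp e e by rewrite /dotp /perp /=; ring.
  by rewrite he; ring.
Qed.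

(** This is how the angle of a reflected vector is computed; the left half plane
of [e] corresponds to the angles on which [acos] inverts [cos]. *)
Lemma acos_frame u e : dotp e e = 1 -> dotp u u = 1 -> 0 < dotp u (perp e) ->
  0 < acos (dotp u e) < pi /\ u = rotate (acos (dotp u e)) e.
Proof.
move=> he hu hp.
have h : dotp u e ^+ 2 + dotp u (perp e) ^+ 2 = 1.
  by rewrite -hu (dotp_frame u u he); ring.
have b : -1 < dotp u e < 1 by apply/andP; split; nra.
have /andP[b1 b2] := b.
have bw : -1 <= dotp u e <= 1 by rewrite !ltW.
split.
  by rewrite acos_gt0 ?acos_ltpi // ?b1 ?b2 ?ltW.
apply: (frame_inj he).
  by rewrite dotp_rotate_id // acosK // in_itv.
rewrite dotp_rotate_perp // sin_acos //.
have -> : 1 - dotp u e ^+ 2 = dotp u (perp e) ^+ 2 by lra.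
by rewrite sqrtr_sqr gtr0_norm.
Qed.

Lemma unit_vec_inj s t : 0 <= s < 2 * pi -> 0 <= t < 2 * pi ->
  unit_vec s = unit_vec t -> s = t.
Proof.
wlog st : s t / s <= t.
  move=> H hs ht h; have [/H|/ltW/H] := leP s t; first by apply.
  by move=> h'; apply/esym/h' => //; exact/esym.
move=> /andP[s0 s1] /andP[t0 t1] [hc hs].
have h1 : cos (t - s) = 1.
  by rewrite cosB hc hs -!expr2 cos2Dsin2.
have p0 := pi_gt0 R.
have [d1|d1] := leP (t - s) pi.
  apply/eqP; rewrite eq_sym -subr_eq0; apply/eqP.
  have <- : acos (cos (t - s)) = t - s.
    by rewrite cosK // in_itv /= d1 subr_ge0 st.
  by rewrite h1 acos1.
exfalso.
have : acos (cos (t - s - 2 * pi)) = - (t - s - 2 * pi).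
  by apply: cosKN; apply/andP; split; lra.
have -> : cos (t - s - 2 * pi) = cos (t - s).
  rewrite [in RHS](_ : t - s = t - s - 2 * pi + pi + pi); last by lra.
  by rewrite !cosDpi opprK.
rewrite h1 acos1; lra.
Qed.

Lemma angle_exists u : dotp u u = 1 ->
  exists2 t, 0 <= t < 2 * pi & u = unit_vec t.
Proof.
move=> hu; have p0 := pi_gt0 R.
have h : u.1 ^+ 2 + u.2 ^+ 2 = 1 by rewrite -hu /dotp; ring.
have b : -1 <= u.1 <= 1 by apply/andP; split; nra.
have [u2|u2] := leP 0 u.2.
  exists (acos u.1).
    by rewrite acos_ge0 //=; have := acos_lepi b; lra.
  rewrite /unit_vec acosK ?in_itv //= sin_acos //.
  have -> : 1 - u.1 ^+ 2 = u.2 ^+ 2 by lra.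
  by rewrite sqrtr_sqr ger0_norm //; case: (u).
exists (2 * pi - acos u.1).
  have /andP[b1 b2] := b.
  have := acos_lepi b; have : 0 < acos u.1.
    by rewrite acos_gt0 // b1 /= lt_neqAle b2 andbT; apply/eqP => h1; nra.
  by move=> ? ?; apply/andP; split; lra.
rewrite /unit_vec; have -> : 2 * pi - acos u.1 = - acos u.1 + pi + pi by lra.
rewrite !cosDpi !sinDpi !opprK cosN sinN acosK ?in_itv //= sin_acos //.
have -> : 1 - u.1 ^+ 2 = u.2 ^+ 2 by lra.
by rewrite sqrtr_sqr ltr0_norm // opprK; case: (u).
Qed.

End Plane.

(** * Induction along a real interval *)

Section RealLine.
Context (R : realType).

(** If [P] fails somewhere, let [t] be the infimum of the failures. The third
hypothesis gives [P t], and the second pushes all failures away from [t]. *)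
Lemma real_induction (T : R) (P : R -> Prop) : P 0 ->
  (forall t, 0 <= t < T -> (forall s, 0 <= s <= t -> P s) ->
     \forall s \near t, t < s -> P s) ->
  (forall t, 0 < t <= T -> (forall s, 0 <= s < t -> P s) -> P t) ->
  forall t, 0 <= t <= T -> P t.
Proof.
move=> P0 Pright Plim t1 /andP[t10 t1T]; apply: contrapT => nP.
pose S : set R := [set s | 0 <= s <= T /\ ~ P s].
have St1 : S t1 by split=> //; rewrite t10.
have infS : has_inf S.
  by split; [exists t1 | exists 0 => s [/andP[]]].
set t := inf S.
have t0 : 0 <= t by apply: lb_le_inf; [exists t1 | move=> s [/andP[]]].
have tt1 : t <= t1 by apply: ge_inf => //; case: infS.
have Plt s : 0 <= s < t -> P s.
  move=> /andP[s0 st]; apply: contrapT => nPs.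
  suff : t <= s by rewrite leNgt st.
  apply: ge_inf; first by case: infS.
  by split=> //; rewrite s0 (le_trans (ltW st)) // (le_trans tt1).
have Pt : P t.
  have [t_gt0|] := ltP 0 t; first by apply: Plim => //; rewrite t_gt0 (le_trans tt1).
  by move=> t_le0; rewrite (_ : t = 0) //; apply/eqP; rewrite eq_le t0 t_le0.
have t_lt : t < t1.
  by rewrite lt_neqAle tt1 andbT; apply/eqP => e; apply: nP; rewrite -e.
have /nbhs_ballP[e /= e0 he] : \forall s \near t, t < s -> P s.
  apply: Pright => [|s /andP[s0]]; first by rewrite t0 (lt_le_trans t_lt).
  rewrite le_eqVlt => /orP[/eqP -> //|st]; apply: Plt; rewrite s0 //.
suff : t + e <= t by rewrite gerDl leNgt e0.
apply: lb_le_inf; first by exists t1.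
move=> s [/andP[s0 sT] nPs]; rewrite leNgt; apply/negP => se; apply: nPs.
have [ts|st] := ltP t s.
  by apply: he => //; rewrite /ball /= ltr_norml; lra.
by move: st; rewrite le_eqVlt => /orP[/eqP -> //|st]; apply: Plt; rewrite s0.
Qed.

(** The estimate is only assumed between [l] and the points near [l], without
uniformity in [l]. This is what is available at an instant of reflection, where a
trajectory can be compared with its neighbours but not the neighbours with each
other. *)
Lemma lipschitz_of_local (f : R -> R * R) (L : R) :
  (forall l : R, 0 <= l <= 1 -> \forall m \near l, 0 <= m <= 1 ->
     enorm (f m - f l) <= L * `|m - l|) ->
  forall l, 0 <= l <= 1 -> enorm (f l - f 0) <= L * l.
Proof.
move=> loc; apply: real_induction.
- by rewrite subrr enorm0 mulr0.
- move=> t /andP[t0 t1] Pt.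
  have := loc t; rewrite t0 (ltW t1) => /(_ isT) /nbhs_ballP[e /= e0 he].
  near=> s => ts.
  have := Pt t; rewrite t0 lexx => /(_ isT) h1.
  have h2 : enorm (f s - f t) <= L * (s - t).
    rewrite -[X in _ * X]gtr0_norm ?subr_gt0 //; apply: he.
      by near: s; apply: nbhsx_ballx.
    rewrite ltW ?(le_lt_trans t0) //=; near: s.
    exact: lt_le_nbhsl.
  by have := enorm_lip (f s) (f t) (f 0); lra.
- move=> t /andP[t0 t1] Pt.
  have := loc t; rewrite (ltW t0) t1 => /(_ isT) /nbhs_ballP[e /= e0 he].
  pose s := Num.max 0 (t - e / 2).
  have s0 : 0 <= s by rewrite le_max lexx.
  have st : s < t by rewrite gt_max t0 /=; lra.
  have se : t - e / 2 <= s by rewrite le_max lexx orbT.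
  have h1 : enorm (f s - f 0) <= L * s by apply: Pt; rewrite s0.
  have h2 : enorm (f s - f t) <= L * (t - s).
    rewrite -[X in _ * X]gtr0_norm ?subr_gt0 // distrC; apply: he.
      by rewrite /ball /= gtr0_norm ?subr_gt0 //; lra.
    by rewrite s0 /=; lra.
  by have := enorm_lip (f t) (f s) (f 0); rewrite (enormBC (f t) (f s)); lra.
Unshelve. all: by end_near.
Qed.

End RealLine.

(** * Convergence in the plane *)

Section PlaneTopology.
Context (R : realType) (T : Type) (F : set_system T) {FF : Filter F}.
Implicit Types (f g : T -> R * R).

Lemma cvg_pair1 f (a : R * R) : f x @[x --> F] --> a -> (f x).1 @[x --> F] --> a.1.
Proof. by move=> h; apply: (cvg_comp _ _ h); exact: cvg_fst. Qed.

Lemma cvg_pair2 f (a : R * R) : f x @[x --> F] --> a -> (f x).2 @[x --> F] --> a.2.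
Proof. by move=> h; apply: (cvg_comp _ _ h); exact: cvg_snd. Qed.

Lemma cvg_pairP f (a : R * R) : (f x).1 @[x --> F] --> a.1 ->
  (f x).2 @[x --> F] --> a.2 -> f x @[x --> F] --> a.
Proof.
case: a => a1 a2 /= h1 h2.
rewrite (_ : f = fun x => ((f x).1, (f x).2)); first exact: (cvg_pair h1 h2).
by apply/funext => x; rewrite -surjective_pairing.
Qed.

Lemma cvg_dotp f g (a b : R * R) : f x @[x --> F] --> a ->
  g x @[x --> F] --> b -> dotp (f x) (g x) @[x --> F] --> dotp a b.
Proof.
move=> hf hg; rewrite /dotp.
by apply: cvgD; apply: cvgM; (exact: cvg_pair1 || exact: cvg_pair2).
Qed.

Lemma near_enorm f (a : R * R) (e : R) : 0 < e -> f x @[x --> F] --> a ->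
  \forall x \near F, enorm (f x - a) < e.
Proof.
move=> e0 h.
have h0 : f x - a @[x --> F] --> (0 : R * R) by rewrite -(subrr a); apply: cvgB => //; exact: cvg_cst.
have h1 : dotp (f x - a) (f x - a) @[x --> F] --> (0 : R).
  by have := cvg_dotp h0 h0; rewrite {2}/dotp /= !mulr0 addr0.
have e20 : 0 < e ^+ 2 by rewrite exprn_gt0.
apply: (filterS _ (cvgr_lt _ h1 _ e20)) => x hx.
rewrite -(ltr_pXn2r (n := 2)) ?nnegrE ?enorm_ge0 ?(ltW e0) //.
by rewrite enorm_sqr.
Qed.

Lemma near_avoid (C : set (R * R)) f (a : R * R) : closed C ->
  f x @[x --> F] --> a -> ~ C a -> \forall x \near F, ~ C (f x).
Proof.
move=> cC h na; apply: (h (~` C)); apply: open_nbhs_nbhs; split => //.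
exact: closed_openC.
Qed.

End PlaneTopology.

Section PlaneBalls.
Context (R : realType).

Lemma nbhs_enorm (a : R * R) (P : set (R * R)) : nbhs a P ->
  exists2 e : R, 0 < e & forall b, enorm (b - a) < e -> P b.
Proof.
move=> /nbhs_ballP[e /= e0 he]; exists e => // b hb; apply: he.
have H (c : R) : c ^+ 2 <= dotp (b - a) (b - a) -> `|c| < e.
  move=> hc; apply: le_lt_trans hb; apply: le_enorm => //.
  by rewrite real_normK ?num_real.
split; rewrite /ball /= distrC; apply: H; rewrite /dotp /=.
- by rewrite -expr2 lerDl -expr2 sqr_ge0.
- by rewrite -[in leRHS]expr2 -[X in _ <= _ + X]expr2 lerDr sqr_ge0.
Qed.

Lemma ray_cvg (p u : R * R) (t : R) : p + s *: u @[s --> t] --> p + t *: u.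
Proof.
apply: cvgD; first exact: cvg_cst.
by apply: cvgZ; [exact: cvg_id|exact: cvg_cst].
Qed.

End PlaneBalls.

(** * Sides and region of a polygon *)

Section Polygon.
Context (R : realType) (Q : polygon R).
Implicit Types (i j k : 'I_(nsides Q)) (p u w x : R * R).

Lemma ordS_neq i : ordS i != i.
Proof.
have h := poly_nsides Q; rewrite -val_eqE /=.
have := ltn_ord i; rewrite leq_eqVlt => /orP[/eqP e|lt].
  rewrite e modnn; apply/eqP => e0; move: e h; rewrite -e0 => <-; by [].
by rewrite modn_small // neq_ltn ltnSn orbT.
Qed.

Lemma dotp_side_gt0 i :
  0 < dotp (vertex (ordS i) - vertex i) (vertex (ordS i) - vertex i).
Proof.
rewrite lt_neqAle dotp_ge0 andbT eq_sym; apply/eqP => h.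
have : enorm (vertex (ordS i) - vertex i) = 0 by rewrite /enorm h sqrtr0.
move=> /enorm_eq0/eqP; rewrite subr_eq0 => /eqP/poly_vertex_inj/eqP.
by rewrite (negbTE (ordS_neq i)).
Qed.

Lemma side_len_gt0 i : 0 < side_len i.
Proof. by rewrite sqrtr_gt0 dotp_side_gt0. Qed.

Lemma side_dirU i : dotp (side_dir i) (side_dir i) = 1.
Proof.
rewrite /side_dir /unit_dir dotpZl dotpC dotpZl -enorm_sqr -/(side_len i).
by have l0 := lt0r_neq0 (side_len_gt0 i); field.
Qed.

Definition normal i := perp (side_dir i).

Lemma normalU i : dotp (normal i) (normal i) = 1.
Proof. by rewrite -(side_dirU i) /normal /dotp /perp /=; ring. Qed.

Lemma dotp_dir_normal i : dotp (side_dir i) (normal i) = 0.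
Proof. exact: dotp_perp. Qed.

Lemma side_lenE i : vertex (ordS i) - vertex i = side_len i *: side_dir i.
Proof.
rewrite /side_dir /unit_dir scalerA -/(side_len i) divff ?scale1r //.
by rewrite gt_eqF // side_len_gt0.
Qed.

(** Coordinates in the frame carried by a side; locally the region is where the
height is positive. *)
Definition along i p := dotp (p - vertex i) (side_dir i).
Definition height i p := dotp (p - vertex i) (normal i).

Lemma alongD i p u : along i (p + u) = along i p + dotp u (side_dir i).
Proof. by rewrite /along -dotpDl addrAC. Qed.

Lemma heightD i p u : height i (p + u) = height i p + dotp u (normal i).
Proof. by rewrite /height -dotpDl addrAC. Qed.

Lemma alongE i p : p = vertex i + along i p *: side_dir i + height i p *: normal i.
Proof.
by rewrite -addrA -(frame (p - vertex i) (side_dirU i)) addrC subrK.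
Qed.

Lemma sideP i p : side i p <-> height i p = 0 /\ 0 <= along i p <= side_len i.
Proof.
split.
  move=> [t /andP[t0 t1] <-]; rewrite side_lenE scalerA.
  rewrite heightD alongD !(dotpZl (t * _)) side_dirU dotp_dir_normal /height /along subrr.
  rewrite [dotp 0 _]/dotp /= !mul0r /dotp /= !mul0r !add0r mulr0 mulr1; split=> //.
  by rewrite mulr_ge0 ?(ltW (side_len_gt0 i)) //= ler_piMl // ltW // side_len_gt0.
move=> [h /andP[a0 a1]]; exists (along i p / side_len i).
  by rewrite /= divr_ge0 ?(ltW (side_len_gt0 i)) //= ler_pdivrMr ?side_len_gt0 // mul1r.
rewrite side_lenE scalerA divfK ?gt_eqF ?side_len_gt0 //.
by rewrite [RHS](alongE i) h scale0r addr0.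
Qed.

Lemma bdryP p : bdry Q p <-> exists i, side i p.
Proof.
rewrite /bdry poly_boundary; split=> [[i _ h]|[i h]]; first by exists i.
by exists i.
Qed.

Definition open_side i p := height i p = 0 /\ 0 < along i p < side_len i.

Lemma open_sideW i p : open_side i p -> side i p.
Proof. by move=> [h /andP[/ltW a /ltW b]]; apply/sideP; rewrite a b. Qed.

Lemma along_vertex i : along i (vertex i) = 0.
Proof. by rewrite /along subrr /dotp /= !mul0r addr0. Qed.

Lemma along_vertexS i : along i (vertex (ordS i)) = side_len i.
Proof. by rewrite /along side_lenE (dotpZl (side_len i)) side_dirU mulr1. Qed.

Lemma open_side_uniq i j p : open_side i p -> side j p -> i = j.
Proof.
move=> oi sj; apply/eqP/negPn/negP => ij.
have [] := poly_simple ij (open_sideW oi) sj => -[e ep]; case: oi => _; subst p.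
  by rewrite e along_vertexS ltxx andbF.
by rewrite along_vertex ltxx.
Qed.

Lemma side_vertexP i p : side i p -> open_side i p \/ exists k, p = vertex k.
Proof.
move=> /sideP[h /andP[]]; rewrite le_eqVlt => /orP[/eqP a0 _|a0].
  by right; exists i; rewrite [LHS](alongE i) h -a0 !scale0r !addr0.
rewrite le_eqVlt => /orP[/eqP a1|a1]; last by left; rewrite /open_side a0 a1.
right; exists (ordS i); rewrite [LHS](alongE i) h a1 scale0r addr0 -side_lenE.
by rewrite addrC subrK.
Qed.

Lemma cvg_along (T : Type) (F : set_system T) {FF : Filter F} (f : T -> R * R)
  (a : R * R) i : f x @[x --> F] --> a -> along i (f x) @[x --> F] --> along i a.
Proof.
by move=> h; apply: cvg_dotp; [apply: cvgB => //|]; exact: cvg_cst.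
Qed.

Lemma cvg_height (T : Type) (F : set_system T) {FF : Filter F} (f : T -> R * R)
  (a : R * R) i : f x @[x --> F] --> a -> height i (f x) @[x --> F] --> height i a.
Proof.
by move=> h; apply: cvg_dotp; [apply: cvgB => //|]; exact: cvg_cst.
Qed.

Lemma closed_side i : closed (side i).
Proof.
have -> : side i = (height i @^-1` [set x : R | x = 0]) `&`
    ((along i @^-1` [set x : R | 0 <= x]) `&`
    (along i @^-1` [set x : R | x <= side_len i])).
  apply/seteqP; split=> p /=; first by move=> /sideP[-> /andP[]].
  by move=> [h [a b]]; apply/sideP; rewrite h a b.
apply: closedI; last apply: closedI; apply: preimage_closed.
- by move=> p _; apply: cvg_height; exact: cvg_id.
- exact: closed_eq.
- by move=> p _; apply: cvg_along; exact: cvg_id.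
- exact: closed_ge.
- by move=> p _; apply: cvg_along; exact: cvg_id.
- exact: closed_le.
Qed.

Lemma closed_region : closed (region Q).
Proof.
apply: compact_closed; last exact: poly_compact.
exact: norm_hausdorff.
Qed.

Lemma bdry_region p : bdry Q p -> region Q p.
Proof. by move=> [h _]; rewrite -(closure_id _).1 // in h; exact: closed_region. Qed.

Lemma region_interior p : region Q p -> ~ bdry Q p -> interior (region Q) p.
Proof.
move=> rp nb; apply: contrapT => ni; apply: nb; split=> //.
exact: subset_closure.
Qed.

(** The region is closed, and off the boundary it is open as well, so the time at
which a ray leaves it is a time on the boundary. *)
Lemma ray_region p u (T : R) : region Q p ->
  (forall t, 0 < t < T -> ~ bdry Q (p + t *: u)) ->
  (exists2 e : R, 0 < e & forall t, 0 < t < e -> region Q (p + t *: u)) ->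
  forall t, 0 <= t <= T -> region Q (p + t *: u).
Proof.
move=> rp nb [e e0 he]; apply: real_induction.
- by rewrite scale0r addr0.
- move=> t /andP[t0 tT] Pt.
  have [t_gt0|t_le0] := ltP 0 t.
    have ht : interior (region Q) (p + t *: u).
      by apply: region_interior; [apply: Pt; rewrite t0 lexx|apply: nb; rewrite t_gt0].
    have h : \forall s \near t, region Q (p + s *: u) by exact: ray_cvg.
    by apply: filterS h.
  have -> : t = 0 by apply/eqP; rewrite eq_le t0 t_le0.
  have h := lt_nbhsl e0.
  by apply: filterS h => s se s0; apply: he; rewrite s0.
- move=> t /andP[t0 tT] Pt; apply: contrapT => nr.
  have := @ray_cvg _ p u t (~` region Q).
  have hn : nbhs (p + t *: u) (~` region Q).
    by apply: open_nbhs_nbhs; split=> //; apply: closed_openC; exact: closed_region.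
  move=> /(_ hn)/nbhs_ballP[d /= d0 hd].
  pose s := Num.max 0 (t - d / 2).
  have s0 : 0 <= s by rewrite le_max lexx.
  have st : s < t by rewrite gt_max t0 /=; lra.
  have sd : t - d / 2 <= s by rewrite le_max lexx orbT.
  apply: (hd s); last by apply: Pt; rewrite s0.
  by rewrite /ball /= gtr0_norm ?subr_gt0 //; lra.
Qed.

End Polygon.

(** * The region near an interior point of a side *)

Section LocalSide.
Context (R : realType) (Q : polygon R).
Implicit Types (i j k : 'I_(nsides Q)) (p u w x : R * R).

Lemma convex_lt (a b c t : R) : 0 <= t <= 1 -> a < c -> b < c ->
  (1 - t) * a + t * b < c.
Proof.
move=> /andP[]; rewrite le_eqVlt => /orP[/eqP <-|t0] t1 ac bc.
  by rewrite subr0 mul1r mul0r addr0.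
have h1 : t * b < t * c by rewrite ltr_pM2l.
have h2 : (1 - t) * a <= (1 - t) * c by rewrite ler_wpM2l ?subr_ge0 // ltW.
by lra.
Qed.

Lemma seg_region p u (T : R) : region Q p ->
  (forall t, 0 <= t <= T -> ~ bdry Q (p + t *: u)) ->
  forall t, 0 <= t <= T -> region Q (p + t *: u).
Proof.
move=> rp nb t /andP[t0 tT].
have nb0 : ~ bdry Q p.
  by have := nb 0; rewrite scale0r addr0; apply; rewrite lexx (le_trans t0).
apply: (ray_region rp) (_ : 0 <= t <= T); last by rewrite t0.
  by move=> s /andP[s0 sT]; apply: nb; rewrite !ltW.
have h : nbhs (p + 0 *: u) (region Q).
  by rewrite scale0r addr0; exact: region_interior.
have /nbhs_ballP[e /= e0 he] : \forall s \near (0 : R), region Q (p + s *: u).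
  exact: ray_cvg.
exists e => // s /andP[s0 se]; apply: he.
by rewrite /ball /= sub0r normrN gtr0_norm.
Qed.

(** Each half of a small disc around [x] misses the boundary and is therefore
entirely inside or entirely outside the region. The left half is inside by
[poly_left]. If the right half were inside too, so would be the whole disc, and [x]
would not be a boundary point. *)
Lemma local_side i x : open_side i x ->
  exists2 rho : R, 0 < rho & forall w, enorm w < rho ->
    [/\ 0 < dotp w (normal i) -> region Q (x + w),
        dotp w (normal i) < 0 -> ~ region Q (x + w),
        bdry Q (x + w) -> dotp w (normal i) = 0
      & dotp w (normal i) = 0 -> open_side i (x + w)].
Proof.
move=> oi; have [hx /andP[a0 a1]] := oi.
have : \forall p \near x, (forall j, i != j -> ~ side j p) /\
    0 < along i p < side_len i.
  apply: filterI.
    have nj j : \forall p \near x, i != j -> ~ side j p.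
      case: (boolP (i == j)) => ij; first by near=> p.
      have nsj : ~ side j x by move=> /(open_side_uniq oi) ij'; rewrite ij' eqxx in ij.
      have h : p @[p --> x] --> x by exact: cvg_id.
      by near=> p => _; near: p; exact: near_avoid (@closed_side _ _ j) h nsj.
    exact: filter_forall nj.
  have h : along i p @[p --> x] --> along i x by apply: cvg_along; exact: cvg_id.
  have h0 := cvgr_gt _ h _ a0; have h1 := cvgr_lt _ h _ a1.
  by near=> p; apply/andP; split; near: p; [exact: h0|exact: h1].
move=> /nbhs_enorm[rho rho0 hrho].
have hB w : enorm w < rho -> bdry Q (x + w) -> dotp w (normal i) = 0.
  move=> wr /bdryP[j sj].
  have [nj _] : (forall j, i != j -> ~ side j (x + w)) /\ 0 < along i (x + w) < side_len i.
    by apply: hrho; rewrite addrC addKr.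
  have [ij|/nj//] := eqVneq i j; subst j; move: sj => /sideP[+ _].
  by rewrite heightD hx add0r.
have hO w : enorm w < rho -> dotp w (normal i) = 0 -> open_side i (x + w).
  move=> wr hw; split; first by rewrite heightD hx hw addr0.
  by apply: (hrho (x + w) _).2; rewrite addrC addKr.
(* The points [x + w] and [x + w'] are in the same half of the disc. *)
have conv w w' : enorm w < rho -> enorm w' < rho ->
    0 < dotp w (normal i) * dotp w' (normal i) -> region Q (x + w) ->
    region Q (x + w').
  move=> wr wr' s rw.
  have := @seg_region (x + w) (w' - w) 1 rw _ 1; rewrite scale1r => H.
  have -> : x + w' = x + w + (w' - w) by rewrite -addrA [w + _]addrC subrK.
  apply: H; last by rewrite ler01 lexx.
  move=> t /andP[t0 t1].
  have -> : x + w + t *: (w' - w) = x + ((1 - t) *: w + t *: w').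
    by rewrite scalerBr scalerBl scale1r -!addrA; congr (_ + (_ + _)); rewrite addrC.
  move=> /hB; rewrite dotpDl !dotpZl => H.
  suff : (1 - t) * dotp w (normal i) + t * dotp w' (normal i) <> 0.
    apply; apply: H; apply: (le_lt_trans (enormD _ _)); rewrite !enormZ !ger0_norm //; last by lra.
    by apply: convex_lt; rewrite ?t0.
  move: s => {H}; set a := dotp w _; set b := dotp w' _ => ab.
  have [a_gt0|a_le0] := ltP 0 a.
    have b_gt0 : 0 < b by rewrite -(pmulr_rgt0 _ a_gt0).
    have := @convex_lt (- a) (- b) 0 t; rewrite t0 t1 !oppr_lt0 => /(_ isT a_gt0 b_gt0).
    by move=> H H'; move: H; rewrite !mulrN -opprD H' oppr0 ltxx.
  have a_lt0 : a < 0.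
    by rewrite lt_neqAle a_le0 andbT; apply/eqP => ea; rewrite ea mul0r ltxx in ab.
  have b_lt0 : b < 0 by rewrite -(nmulr_rgt0 _ a_lt0).
  by apply/eqP; rewrite lt_eqF // convex_lt ?t0.
have nn h : dotp (h *: normal i) (normal i) = h by rewrite dotpZl normalU mulr1.
have en h : enorm (h *: normal i) = `|h|.
  by rewrite enormZ (enorm1P (normalU i)) mulr1.
have left w : enorm w < rho -> 0 < dotp w (normal i) -> region Q (x + w).
  move=> wr wn; have tb : 0 < along i x / side_len i < 1.
    by rewrite divr_gt0 ?side_len_gt0 //= ltr_pdivrMr ?side_len_gt0 // mul1r.
  have [eps eps0 heps] := poly_left i tb.
  pose h := Num.min eps rho / 2.
  have m0 : 0 < Num.min eps rho by rewrite lt_min eps0.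
  have me : Num.min eps rho <= eps by rewrite ge_min lexx.
  have mr : Num.min eps rho <= rho by rewrite ge_min lexx orbT.
  have h0 : 0 < h by rewrite divr_gt0.
  apply: (conv (h *: normal i)) => //.
  + by rewrite en gtr0_norm // /h; lra.
  + by rewrite nn mulr_gt0.
  + have := heps h; rewrite side_lenE scalerA divfK ?gt_eqF ?side_len_gt0 //.
    rewrite rotate_pihalf -/(side_dir i) -/(normal i).
    have <- : x = vertex i + along i x *: side_dir i.
      by rewrite [LHS](alongE i) hx scale0r addr0.
    by apply; rewrite h0 /h /=; lra.
exists rho => // w wr; split; [exact: left| |exact: hB|exact: hO].
move=> wn rw.
  have [_] : bdry Q x by apply/bdryP; exists i; exact: open_sideW.
  apply.
  apply/nbhs_ballP; exists (rho / 2) => /=; first by rewrite divr_gt0.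
  move=> y [/= h1 h2].
  have yx : y = x + (y - x) by rewrite addrC subrK.
  have yr : enorm (y - x) < rho.
    apply: (@le_lt_trans _ _ (`|(y - x).1| + `|(y - x).2|)).
      apply: enorm_le; first by rewrite addr_ge0.
      rewrite sqrrD !real_normK ?num_real // /dotp -!expr2.
      by rewrite -addrA lerD2l lerDr mulrn_wge0 // mulr_ge0.
    by move: h1 h2; rewrite /ball /= !(distrC x.1) !(distrC x.2) /=; lra.
  rewrite yx; have [z|z|z] := ltrgtP (dotp (y - x) (normal i)) 0.
  + by apply: (conv w) => //; rewrite nmulr_rgt0.
  + exact: left.
  + apply: bdry_region; apply/bdryP; exists i; apply: open_sideW; exact: hO.
Unshelve. all: by end_near.
Qed.

End LocalSide.

(** * Unfolded trajectories and itineraries *)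

Section Itineraries.
Context (R : realType) (Q : polygon R).
Implicit Types (i j : 'I_(nsides Q)) (p u w x z : R * R) (t : R) (k m : nat).
Implicit Types (c : nat -> 'I_(nsides Q)).

Lemma side_start_le i j : (i < j)%N -> side_start i + side_len i <= side_start j.
Proof.
move=> ij; rewrite /side_start (big_mkcond (fun k : 'I__ => (k < j)%N)).
rewrite (big_mkcond (fun k : 'I__ => (k < i)%N)) (bigD1 i) //= ltnn add0r [leRHS](bigD1 i) //= ij [leLHS]addrC lerD2l.
apply: ler_sum => k ki; case: ifP => [/ltn_trans/(_ ij) -> //|_].
by case: ifP => // _; rewrite ltW // side_len_gt0.
Qed.

Lemma in_open_side_uniq i j (s : R) : in_open_side i s ->
  side_start j <= s < side_start j + side_len j -> i = j.
Proof.
move=> /andP[i0 i1] /andP[j0 j1]; apply/val_inj => /=.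
by have [/side_start_le h|/side_start_le h|//] := ltngtP i j; exfalso; lra.
Qed.

Lemma in_open_sideW i (s : R) : in_open_side i s ->
  side_start i <= s < side_start i + side_len i.
Proof. by move=> /andP[/ltW -> ->]. Qed.

Lemma height_arc i (s : R) : height i (arc_point i s) = 0.
Proof.
rewrite /height /arc_point addrAC subrr add0r (dotpZl (s - _)).
by rewrite dotp_dir_normal mulr0.
Qed.

Lemma along_arc i (s : R) : along i (arc_point i s) = s - side_start i.
Proof.
rewrite /along /arc_point addrAC subrr add0r (dotpZl (s - _)).
by rewrite side_dirU mulr1.
Qed.

Lemma open_side_arc i (s : R) : open_side i (arc_point i s) <-> in_open_side i s.
Proof.
rewrite /open_side height_arc along_arc /in_open_side subr_gt0 ltrBlDl.
by split=> // -[].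
Qed.

Lemma arc_along i p : height i p = 0 -> arc_point i (side_start i + along i p) = p.
Proof.
move=> h; rewrite /arc_point addrAC subrr add0r [RHS](alongE i) h.
by rewrite scale0r addr0.
Qed.

(** Reflection of points in the line carrying a side, and its linear part on
directions. *)
Definition reflect_side i p := p - (2 * height i p) *: normal i.
Definition reflect_dir i u := u - (2 * dotp u (normal i)) *: normal i.

Lemma reflect_sideD i p u : reflect_side i (p + u) = reflect_side i p + reflect_dir i u.
Proof.
by rewrite /reflect_side /reflect_dir heightD mulrDr scalerDl opprD addrACA.
Qed.

Lemma reflect_dirZ i t u : reflect_dir i (t *: u) = t *: reflect_dir i u.
Proof. by rewrite /reflect_dir (dotpZl t u) scalerBr scalerA mulrCA. Qed.

Lemma reflect_dir_normal i u :
  dotp (reflect_dir i u) (normal i) = - dotp u (normal i).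
Proof. by rewrite /reflect_dir dotpBl (dotpZl (2 * _)) normalU; ring. Qed.

Lemma reflect_dirK i u : dotp (reflect_dir i u) (reflect_dir i u) = dotp u u.
Proof.
rewrite {2}/reflect_dir (dotpC (reflect_dir i u)) dotpBl (dotpZl (2 * _)).
rewrite (dotpC (normal i)) reflect_dir_normal.
rewrite dotpC /reflect_dir dotpBl (dotpZl (2 * _)) (dotpC (normal i)); ring.
Qed.

Lemma reflect_dirE i u : reflect_along (side_dir i) u = reflect_dir i u.
Proof. by rewrite reflect_alongE // side_dirU. Qed.

(** The trajectory with code [c] is described by straight lines parametrised by
the total time: [line c k z t] is the position at time [t] if [t] lies between the
[k]-th and the next reflection, and [line c k.+1] is the mirror image of
[line c k] in the side [c k.+1]. Everything is defined for all [z], [t] and [c],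
whether or not a trajectory with this code exists, and depends continuously on [z]. *)
Fixpoint unfold_pos c k z : R * R :=
  if k is k'.+1 then reflect_side (c k) (unfold_pos c k' z) else arc_point (c 0%N) z.1.

Fixpoint unfold_dir c k z : R * R :=
  if k is k'.+1 then reflect_dir (c k) (unfold_dir c k' z) else rotate z.2 (side_dir (c 0%N)).

Definition line c k z t := unfold_pos c k z + t *: unfold_dir c k z.

(** The time at which [line c k.-1 z] crosses the line that carries the side
[c k]; the launch takes place at time [0]. *)
Definition htime c k z : R :=
  if k is k'.+1 then
    - height (c k) (unfold_pos c k' z) / dotp (unfold_dir c k' z) (normal (c k))
  else 0.

(** All these conditions are open in [z]. For this reason the sides [c k] and
[c k.+1], which are touched at the end points, are left out of the last clause; the
signs of the normal components keep the open segment off them. *)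
Definition flight c k z :=
  [/\ htime c k z < htime c k.+1 z,
      dotp (unfold_dir c k z) (normal (c k.+1)) < 0,
      0 < along (c k.+1) (line c k z (htime c k.+1 z)) < side_len (c k.+1)
    & forall j, j != c k -> j != c k.+1 -> forall s : R, 0 <= s <= 1 ->
        ~ side j (line c k z (htime c k z + s * (htime c k.+1 z - htime c k z)))].

Definition itin c m z :=
  [/\ in_open_side (c 0%N) z.1, 0 < z.2 < pi & forall k, (k < m)%N -> flight c k z].

Lemma itinW c m k z : (k <= m)%N -> itin c m z -> itin c k z.
Proof. by move=> km [h0 h1 h]; split=> // l lk; apply: h; exact: leq_trans km. Qed.

Lemma unfold_dirU c k z : dotp (unfold_dir c k z) (unfold_dir c k z) = 1.
Proof. by elim: k => [|k IH] /=; rewrite ?dotp_rotate ?side_dirU ?reflect_dirK. Qed.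

Lemma lineS c k z t : line c k.+1 z t = reflect_side (c k.+1) (line c k z t).
Proof. by rewrite /line /= -reflect_dirZ -reflect_sideD. Qed.

Lemma lineB c k z s t : line c k z t = line c k z s + (t - s) *: unfold_dir c k z.
Proof. by rewrite /line -addrA -scalerDl [s + _]addrC subrK. Qed.

Lemma reflect_side_dist i p q :
  enorm (reflect_side i p - reflect_side i q) = enorm (p - q).
Proof.
have {1}-> : p = q + (p - q) by rewrite addrC subrK.
by rewrite reflect_sideD addrAC subrr add0r /enorm reflect_dirK.
Qed.

(** Under a common code, two trajectories are seen at time [t] through the same
composition of reflections. *)
Lemma line_dist c k z z' t :
  enorm (line c k z t - line c k z' t) = enorm (line c 0 z t - line c 0 z' t).
Proof. by elim: k => // k IH; rewrite !lineS reflect_side_dist. Qed.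

Lemma height_line c k z t i : height i (line c k z t) =
  height i (unfold_pos c k z) + t * dotp (unfold_dir c k z) (normal i).
Proof. by rewrite heightD (dotpZl t). Qed.

Lemma height_hit c k z : dotp (unfold_dir c k z) (normal (c k.+1)) != 0 ->
  height (c k.+1) (line c k z (htime c k.+1 z)) = 0.
Proof. by move=> h; rewrite height_line /= divfK // subrr. Qed.

Lemma line_hit c k z : dotp (unfold_dir c k z) (normal (c k.+1)) != 0 ->
  line c k.+1 z (htime c k.+1 z) = line c k z (htime c k.+1 z).
Proof.
by move=> h; rewrite lineS /reflect_side height_hit // mulr0 scale0r subr0.
Qed.

Lemma flight_hit c k z : flight c k z ->
  open_side (c k.+1) (line c k z (htime c k.+1 z)).
Proof. by move=> [_ h ho _]; split=> //; apply: height_hit; rewrite lt_eqF. Qed.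

Lemma itin_open c m z : itin c m z -> open_side (c m) (line c m z (htime c m z)).
Proof.
case: m => [[h _ _]|m [_ _ /(_ _ (ltnSn m)) h]].
  by rewrite /line scale0r addr0; apply/open_side_arc.
rewrite line_hit; first exact: flight_hit.
by case: h => _ + _ _; rewrite lt_neqAle => /andP[].
Qed.

Lemma itin_out c m z : itin c m z -> 0 < dotp (unfold_dir c m z) (normal (c m)).
Proof.
case: m => [[_ h _]|m [_ _ /(_ _ (ltnSn m)) [_ h _ _]]] /=.
  by rewrite dotp_rotate_perp ?side_dirU // sin_gt0_pi.
by rewrite reflect_dir_normal oppr_gt0.
Qed.

Lemma flight_free c m z : itin c m.+1 z -> forall t,
  htime c m z < t < htime c m.+1 z -> ~ bdry Q (line c m z t).
Proof.
move=> h t /andP[t0 t1] /bdryP[j].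
have [T0 hn _ hj] := let: And3 _ _ f := h in f _ (ltnSn m).
have hm := itinW (leqnSn m) h.
have [->|jm] := eqVneq j (c m).
  move=> /sideP[+ _]; rewrite (lineB c m z (htime c m z)) heightD.
  have [-> _] := itin_open hm; rewrite add0r (dotpZl (t - _)).
  have := itin_out hm => h1 h2; have : 0 < (t - htime c m z) * dotp (unfold_dir c m z) (normal (c m)).
    by rewrite mulr_gt0 // subr_gt0.
  by rewrite h2 ltxx.
have [->|jm1] := eqVneq j (c m.+1).
  move=> /sideP[+ _]; rewrite (lineB c m z (htime c m.+1 z)) heightD.
  rewrite height_hit ?lt_eqF // add0r (dotpZl (t - _)) => h2.
  have : 0 < (t - htime c m.+1 z) * dotp (unfold_dir c m z) (normal (c m.+1)).
    by rewrite nmulr_lgt0 // subr_lt0.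
  by rewrite h2 ltxx.
pose T := htime c m.+1 z - htime c m z.
have Tp : 0 < T by rewrite subr_gt0.
have := hj j jm jm1 ((t - htime c m z) / T).
rewrite -/T divfK ?gt_eqF // [_ + (t - _)]addrC subrK; apply.
apply/andP; split; first by rewrite divr_ge0 // ?subr_ge0 ltW.
by rewrite ler_pdivrMr // mul1r lerD2r ltW.
Qed.

Lemma htime_lt c m z : itin c m.+1 z -> htime c m z < htime c m.+1 z.
Proof. by case=> _ _ /(_ _ (ltnSn m)) []. Qed.

Lemma htime_le c m k z : itin c m z -> (k <= m)%N -> htime c k z <= htime c m z.
Proof.
elim: m => [|m IH] h; first by rewrite leqn0 => /eqP ->.
rewrite leq_eqVlt => /orP[/eqP -> //|km].
by rewrite (le_trans (IH (itinW (leqnSn m) h) km)) // ltW // htime_lt.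
Qed.

Lemma line_ext c c' k z : (forall l, (l <= k)%N -> c l = c' l) ->
  unfold_pos c k z = unfold_pos c' k z /\ unfold_dir c k z = unfold_dir c' k z.
Proof.
elim: k => [|k IH] h; first by rewrite /= h.
have [|e1 e2] := IH; first by move=> l lk; apply: h; rewrite leqW.
by rewrite /= e1 e2 h.
Qed.

Lemma htime_ext c c' k z : (forall l, (l <= k)%N -> c l = c' l) ->
  htime c k z = htime c' k z.
Proof.
case: k => // k h /=.
have [|e1 e2] := @line_ext c c' k z; first by move=> l lk; apply: h; rewrite leqW.
by rewrite e1 e2 h.
Qed.

Lemma lineE_ext c c' k z : (forall l, (l <= k)%N -> c l = c' l) ->
  line c k z = line c' k z.
Proof. by move=> h; rewrite /line; have [-> ->] := line_ext z h. Qed.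

Lemma flight_ext c c' k z : (forall l, (l <= k.+1)%N -> c l = c' l) ->
  flight c k z -> flight c' k z.
Proof.
move=> h; rewrite /flight.
have hk l : (l <= k)%N -> c l = c' l by move=> lk; apply: h; rewrite leqW.
rewrite (lineE_ext z hk) (htime_ext z h) (htime_ext z hk) (line_ext z hk).2.
by rewrite (h k.+1) // (hk k).
Qed.

Lemma itin_ext c c' m z : (forall l, (l <= m)%N -> c l = c' l) ->
  itin c m z -> itin c' m z.
Proof.
move=> h [h0 h1 hf]; split=> //; first by rewrite -h.
move=> k km; apply: flight_ext (hf k km) => l lk.
by apply: h; exact: leq_trans km.
Qed.

(** Two codes of [z] cannot split: the earlier of the two hits would happen in the
middle of the flight described by the other code. *)
Lemma itin_det c c' m z : itin c m z -> itin c' m z ->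
  forall k, (k <= m)%N -> c k = c' k.
Proof.
elim: m => [|m IH] h h' k.
  rewrite leqn0 => /eqP ->; case: h h' => [h _ _] [/in_open_sideW h' _ _].
  exact: in_open_side_uniq h h'.
have E := IH (itinW (leqnSn m) h) (itinW (leqnSn m) h').
rewrite leq_eqVlt => /orP[/eqP ->|]; last by rewrite ltnS; exact: E.
have hb := flight_free h; have hb' := flight_free h'.
have T := htime_lt h; have T' := htime_lt h'.
have hh : open_side (c m.+1) (line c m z (htime c m.+1 z)).
  by apply: flight_hit; case: h => _ _; apply.
have hh' : open_side (c' m.+1) (line c' m z (htime c' m.+1 z)).
  by apply: flight_hit; case: h' => _ _; apply.
rewrite -(lineE_ext z E) -(htime_ext z E) in hb' T' hh'.
have [lt|lt|e] := ltgtP (htime c m.+1 z) (htime c' m.+1 z).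
- case: (hb' (htime c m.+1 z)); first by rewrite T.
  by apply/bdryP; exists (c m.+1); exact: open_sideW.
- case: (hb (htime c' m.+1 z)); first by rewrite T'.
  by apply/bdryP; exists (c' m.+1); exact: open_sideW.
- by apply: (open_side_uniq hh); rewrite e; exact: open_sideW.
Qed.

End Itineraries.

(** * Stability of itineraries *)

Section Continuity.
Context (R : realType) (Q : polygon R).
Context (T : Type) (F : set_system T) {FF : Filter F}.
Implicit Types (i j : 'I_(nsides Q)) (k m : nat) (c : nat -> 'I_(nsides Q)).
Implicit Types (zf pf uf : T -> R * R) (tf : T -> R) (z p u : R * R) (t : R).

Lemma cvg_reflect_side i pf p : pf x @[x --> F] --> p ->
  reflect_side i (pf x) @[x --> F] --> reflect_side i p.
Proof.
move=> h; apply: cvgB => //; apply: cvgZ; last exact: cvg_cst.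
by apply: cvgM; [exact: cvg_cst|exact: cvg_height].
Qed.

Lemma cvg_reflect_dir i uf u : uf x @[x --> F] --> u ->
  reflect_dir i (uf x) @[x --> F] --> reflect_dir i u.
Proof.
move=> h; apply: cvgB => //; apply: cvgZ; last exact: cvg_cst.
by apply: cvgM; [exact: cvg_cst|apply: cvg_dotp => //; exact: cvg_cst].
Qed.

Lemma cvg_unfold_pos c k zf z : zf x @[x --> F] --> z ->
  unfold_pos c k (zf x) @[x --> F] --> unfold_pos c k z.
Proof.
move=> h; elim: k => [|k IH] /=; last exact: cvg_reflect_side.
apply: cvgD; first exact: cvg_cst.
apply: cvgZ; last exact: cvg_cst.
by apply: cvgB; [exact: cvg_pair1|exact: cvg_cst].
Qed.

Lemma cvg_unfold_dir c k zf z : zf x @[x --> F] --> z ->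
  unfold_dir c k (zf x) @[x --> F] --> unfold_dir c k z.
Proof.
move=> h; elim: k => [|k IH] /=; last exact: cvg_reflect_dir.
have h2 := cvg_pair2 h.
have hc : cos (zf x).2 @[x --> F] --> cos z.2.
  by apply: (cvg_comp _ _ h2); exact: continuous_cos.
have hs : sin (zf x).2 @[x --> F] --> sin z.2.
  by apply: (cvg_comp _ _ h2); exact: continuous_sin.
by apply: cvg_pairP; [apply: cvgB|apply: cvgD]; apply: cvgM => //; exact: cvg_cst.
Qed.

Lemma cvg_line c k zf z tf t : zf x @[x --> F] --> z -> tf x @[x --> F] --> t ->
  line c k (zf x) (tf x) @[x --> F] --> line c k z t.
Proof.
by move=> hz ht; apply: cvgD; [|apply: cvgZ => //]; [exact: cvg_unfold_pos|exact: cvg_unfold_dir].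
Qed.

Lemma cvg_htime c k zf z : zf x @[x --> F] --> z -> itin c k z ->
  htime c k (zf x) @[x --> F] --> htime c k z.
Proof.
move=> hz; case: k => [|k] h; first exact: cvg_cst.
have [_ hn _ _] := let: And3 _ _ f := h in f _ (ltnSn k).
apply: cvgM; first by apply: cvgN; apply: cvg_height; exact: cvg_unfold_pos.
apply: cvgV; first by rewrite lt_eqF.
by apply: cvg_dotp; [exact: cvg_unfold_dir|exact: cvg_cst].
Qed.

(** Tube lemma: the segment of times is compact and the complement of [C] is
open. *)
Lemma near_seg_avoid (C : set (R * R)) (f : T -> R -> R * R) (g : R -> R * R) :
  closed C ->
  (forall s : R, 0 <= s <= 1 -> f y.2 y.1 @[y --> filter_prod (nbhs s) F] --> g s) ->
  (forall s, 0 <= s <= 1 -> ~ C (g s)) ->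
  \forall x \near F, forall s : R, 0 <= s <= 1 -> ~ C (f x s).
Proof.
move=> cC hf hg.
have := @segment_compact R 0 1 => /compact_near_coveringP cov.
have := cov T F (fun x s => ~ C (f x s)) FF.
rewrite /= => H.
have : \forall x \near F, `[0, 1]%classic `<=` (fun s => ~ C (f x s)).
  apply: H => s /=; rewrite in_itv /= => s01.
  exact: near_avoid cC (hf s s01) (hg s s01).
by apply: filterS => x hx s s01; apply: hx; rewrite /= in_itv.
Qed.

Lemma near_in_itv tf t (a b : R) : tf x @[x --> F] --> t -> a < t < b ->
  \forall x \near F, a < tf x < b.
Proof.
move=> h /andP[ta tb]; have h1 := cvgr_gt _ h _ ta; have h2 := cvgr_lt _ h _ tb.
by near=> x; apply/andP; split; near: x; [exact: h1|exact: h2].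
Unshelve. all: by end_near.
Qed.

Lemma cvg_lt2 (f g : T -> R) (a b : R) : f x @[x --> F] --> a ->
  g x @[x --> F] --> b -> a < b -> \forall x \near F, f x < g x.
Proof.
move=> hf hg ab.
have h : g x - f x @[x --> F] --> b - a by exact: cvgB.
have b0 : 0 < b - a by rewrite subr_gt0.
near=> x; rewrite -subr_gt0; near: x; exact: cvgr_gt h _ b0.
Unshelve. all: by end_near.
Qed.

End Continuity.

Section ItineraryOpen.
Context (R : realType) (Q : polygon R).
Context (T : Type) (F : set_system T) {FF : Filter F}.
Implicit Types (i j : 'I_(nsides Q)) (k m : nat) (c : nat -> 'I_(nsides Q)).
Implicit Types (zf : T -> R * R) (tf : T -> R) (z : R * R).

Lemma near_line_not_side c m j zf z (af bf : T -> R) (a b : R) :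
  zf x @[x --> F] --> z -> af x @[x --> F] --> a -> bf x @[x --> F] --> b ->
  (forall s : R, 0 <= s <= 1 -> ~ side j (line c m z (a + s * (b - a)))) ->
  \forall x \near F, forall s : R, 0 <= s <= 1 ->
    ~ side j (line c m (zf x) (af x + s * (bf x - af x))).
Proof.
move=> hz ha hb.
apply: (@near_seg_avoid _ _ _ _ _
  (fun x s => line c m (zf x) (af x + s * (bf x - af x))) _ (@closed_side _ _ j)) => s _ /=.
have G (V : topologicalType) (g : T -> V) (v : V) : g x @[x --> F] --> v ->
    g y.2 @[y --> filter_prod (nbhs s) F] --> v.
  by move=> hg; apply: (cvg_comp _ _ _ hg); exact: cvg_snd.
apply: cvg_line; first exact: G.
apply: cvgD; first exact: G.
apply: cvgM; first exact: cvg_fst.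
by apply: cvgB; exact: G.
Qed.

Lemma near_itin c m zf z : zf x @[x --> F] --> z -> itin c m z ->
  \forall x \near F, itin c m (zf x).
Proof.
move=> hz; elim: m => [|m IH] h.
  have [h0 h1 _] := h.
  have n0 : \forall x \near F, in_open_side (c 0%N) (zf x).1.
    exact: near_in_itv (cvg_pair1 hz) h0.
  have n1 : \forall x \near F, 0 < (zf x).2 < pi.
    exact: near_in_itv (cvg_pair2 hz) h1.
  by near=> x; split=> //; near: x; [exact: n0|exact: n1].
have hm := itinW (leqnSn m) h.
have [h1 h2 h3 h4] := let: And3 _ _ f := h in f _ (ltnSn m).
have nm := IH hm.
have ct : htime c m (zf x) @[x --> F] --> htime c m z by exact: cvg_htime.
have ct1 : htime c m.+1 (zf x) @[x --> F] --> htime c m.+1 z by exact: cvg_htime.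
have n1 : \forall x \near F, htime c m (zf x) < htime c m.+1 (zf x) by exact: cvg_lt2 ct ct1 h1.
have n2 : \forall x \near F, dotp (unfold_dir c m (zf x)) (normal (c m.+1)) < 0.
  have hd : dotp (unfold_dir c m (zf x)) (normal (c m.+1)) @[x --> F] -->
    dotp (unfold_dir c m z) (normal (c m.+1)).
    by apply: cvg_dotp; [exact: cvg_unfold_dir|exact: cvg_cst].
  exact: cvgr_lt hd _ h2.
have n3 : \forall x \near F, 0 < along (c m.+1) (line c m (zf x) (htime c m.+1 (zf x)))
    < side_len (c m.+1).
  by apply: near_in_itv h3; apply: cvg_along; exact: cvg_line.
have n4 j : \forall x \near F, j != c m -> j != c m.+1 -> forall s : R,
    0 <= s <= 1 -> ~ side j (line c m (zf x)
    (htime c m (zf x) + s * (htime c m.+1 (zf x) - htime c m (zf x)))).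
  case: (boolP (j == c m)) => jm; first by near=> x.
  case: (boolP (j == c m.+1)) => jm1; first by near=> x.
  have := near_line_not_side hz ct ct1 (h4 j jm jm1).
  by apply: filterS => x hx _ _.
near=> x.
have [e0 e1 e2] : itin c m (zf x) by near: x; exact: nm.
split=> // k; rewrite ltnS leq_eqVlt => /orP[/eqP ->|/e2 //].
by split; near: x; [exact: n1|exact: n2|exact: n3|exact: filter_forall n4].
Unshelve. all: by end_near.
Qed.

End ItineraryOpen.

(** * Itineraries are orbits of the billiard map *)

Section Conversion.
Context (R : realType) (Q : polygon R).
Implicit Types (i j : 'I_(nsides Q)) (p u w x z : R * R) (t : R) (k m : nat).
Implicit Types (c : nat -> 'I_(nsides Q)).

Lemma lineD c k z s t : line c k z (s + t) = line c k z s + t *: unfold_dir c k z.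
Proof. by rewrite /line scalerDl addrA. Qed.

(** Coordinates of the vector that leaves the [k]-th reflection. *)
Definition coords c k z : R * R :=
  (side_start (c k) + along (c k) (line c k z (htime c k z)),
   acos (dotp (unfold_dir c k z) (side_dir (c k)))).

Lemma coords0 c z : 0 < z.2 < pi -> coords c 0 z = z.
Proof.
move=> /andP[/ltW z0 /ltW z1]; rewrite /coords /line /= scale0r addr0 along_arc.
rewrite addrC subrK dotp_rotate_id ?side_dirU // cosK ?in_itv /= ?z0 //.
by rewrite -surjective_pairing.
Qed.

Lemma coords_in_open_side c m z : itin c m z -> in_open_side (c m) (coords c m z).1.
Proof.
move=> /itin_open h; apply/open_side_arc; rewrite arc_along //; exact: h.1.
Qed.

Lemma coords_arc c m z : itin c m z ->
  arc_point (c m) (coords c m z).1 = line c m z (htime c m z).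
Proof. by move=> /itin_open [h _]; rewrite arc_along. Qed.

Lemma coords_angle c m z : itin c m z ->
  0 < (coords c m z).2 < pi /\ rotate (coords c m z).2 (side_dir (c m)) = unfold_dir c m z.
Proof.
move=> /itin_out h; have [h1 <-] := acos_frame (side_dirU (c m)) (unfold_dirU c m z) h.
by [].
Qed.

Lemma coords_vector_at c m z (psi : R) : itin c m z -> 0 <= psi < 2 * pi ->
  unfold_dir c m z = unit_vec psi ->
  vector_at Q (coords c m z) (line c m z (htime c m z), psi).
Proof.
move=> h hpsi e; split => //; exists (c m); split => /=.
- exact: in_open_sideW (coords_in_open_side h).
- by rewrite coords_arc.
- by rewrite (coords_angle h).2.
Qed.

Lemma coords_phase_space c m z : itin c m z -> phase_space Q (coords c m z).
Proof.
move=> h; split.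
  by have [/andP[h0 h1] _] := coords_angle h; rewrite ltW //= (lt_trans h1) // ltr_pMl ?pi_gt0 // ltr1n.
have [psi hpsi e] := angle_exists (unfold_dirU c m z).
exists (line c m z (htime c m z), psi); first exact: coords_vector_at.
have [rho rho0 hrho] := local_side (itin_open h).
exists rho => // t /andP[t0 tr] /=; rewrite -e.
have [|+ _ _ _] := hrho (t *: unfold_dir c m z); last first.
  by apply; rewrite (dotpZl t) mulr_gt0 // itin_out.
by rewrite enormZ (enorm1P (unfold_dirU c m z)) mulr1 gtr0_norm.
Qed.

Lemma itin_step c m z : itin c m.+1 z ->
  billiard_step Q (coords c m z) (htime c m.+1 z - htime c m z) (coords c m.+1 z).
Proof.
move=> h; have hm := itinW (leqnSn m) h.
have T := htime_lt h.
split; [exact: coords_phase_space|exact: coords_phase_space|by rewrite subr_gt0|].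
have [psi hpsi e] := angle_exists (unfold_dirU c m z).
have [psi' hpsi' e'] := angle_exists (unfold_dirU c m.+1 z).
exists (c m), (c m.+1), (line c m z (htime c m z), psi),
  (line c m.+1 z (htime c m.+1 z), psi'); split => /=.
- by split; exact: coords_in_open_side.
- by split; exact: coords_vector_at.
- rewrite -e -lineB line_hit //.
  by case: h => _ _ /(_ _ (ltnSn m)) [_ + _ _]; rewrite lt_neqAle => /andP[].
- move=> t /andP[t0 t1]; rewrite -e.
  by rewrite -lineD; apply: (flight_free h); rewrite ltrDl t0 -ltrBrDl.
- by rewrite -e' -e reflect_dirE.
Qed.

Lemma itin_iter c m z : itin c m z ->
  forall k, (k <= m)%N -> billiard_iter Q k z (coords c k z).
Proof.
move=> h; elim=> [|k IH] km.
  have h0 := itinW km h; split; last by rewrite coords0 //; case: h0.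
  by have := coords_phase_space h0; rewrite coords0 //; case: h0.
exists (coords c k z); first by apply: IH; exact: ltnW.
by eexists; apply: itin_step; exact: itinW h.
Qed.

Lemma inward_dotp i (p : (R * R) * R) : open_side i p.1 -> inward Q p ->
  0 <= dotp (unit_vec p.2) (normal i).
Proof.
move=> oi [e e0 he]; rewrite leNgt; apply/negP => neg.
have [rho rho0 hrho] := local_side oi.
pose t := Num.min e rho / 2.
have m0 : 0 < Num.min e rho by rewrite lt_min e0.
have me : Num.min e rho <= e by rewrite ge_min lexx.
have mr : Num.min e rho <= rho by rewrite ge_min lexx orbT.
have t0 : 0 < t by rewrite divr_gt0.
have [|_ + _ _] := hrho (t *: unit_vec p.2).
  by rewrite enormZ (enorm1P (dotp_unit_vec _)) mulr1 gtr0_norm // /t; lra.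
apply; first by rewrite (dotpZl t) pmulr_rlt0.
by apply: he; rewrite t0 /t; lra.
Qed.

Lemma not_tangent i x u (tau : R) : open_side i x -> enorm u = 1 -> 0 < tau ->
  (forall t, 0 < t < tau -> ~ bdry Q (x + t *: u)) -> dotp u (normal i) != 0.
Proof.
move=> oi u1 tau0 free; apply/eqP => h.
have [rho rho0 hrho] := local_side oi.
pose t := Num.min tau rho / 2.
have m0 : 0 < Num.min tau rho by rewrite lt_min tau0.
have me : Num.min tau rho <= tau by rewrite ge_min lexx.
have mr : Num.min tau rho <= rho by rewrite ge_min lexx orbT.
have t0 : 0 < t by rewrite divr_gt0.
have [|_ _ _ ho] := hrho (t *: u).
  by rewrite enormZ u1 mulr1 gtr0_norm // /t; lra.
apply: (free t); first by rewrite t0 /t; lra.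
by apply/bdryP; exists i; apply/open_sideW/ho; rewrite (dotpZl t) h mulr0.
Qed.

Lemma angle_transversal t : 0 <= t < 2 * pi -> 0 <= sin t -> sin t != 0 -> 0 < t < pi.
Proof.
move=> /andP[t0 t1] s0 s1; have p0 := pi_gt0 R.
have tn0 : t != 0 by apply: contraNneq s1 => ->; rewrite sin0.
rewrite lt_neqAle eq_sym tn0 t0 /= ltNge; apply/negP => pt.
have : 0 <= sin (t - pi) by apply: sin_ge0_pi; apply/andP; split; lra.
have -> : sin (t - pi) = - sin t.
  by rewrite -[in RHS](subrK pi t) sinDpi opprK.
rewrite oppr_ge0 => h; case/negP: s1; apply/eqP/le_anti; by rewrite h.
Qed.

Lemma vector_at_open i z (p : (R * R) * R) : in_open_side i z.1 -> vector_at Q z p ->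
  p.1 = arc_point i z.1 /\ unit_vec p.2 = rotate z.2 (side_dir i).
Proof.
move=> hi [_ [i' [h1 h2 h3]]].
by have e := in_open_side_uniq hi h1; subst i'.
Qed.

Lemma step_transversal z (tau : R) z' : billiard_step Q z tau z' ->
  exists2 i : 'I_(nsides Q), in_open_side i z.1 & 0 < z.2 < pi.
Proof.
move=> [hz _ tau0 [i [j [p [p' [[hi hj] [hp hp'] _ free _]]]]]].
exists i => //; have [h2 [q hq inq]] := hz.
have [e1 e2] := vector_at_open hi hp; have [f1 f2] := vector_at_open hi hq.
have oi : open_side i p.1 by rewrite e1; apply/open_side_arc.
have s : dotp (unit_vec p.2) (normal i) = sin z.2.
  by rewrite e2 dotp_rotate_perp // side_dirU.
apply: angle_transversal => //.
- by rewrite -s e2 -f2; apply: inward_dotp => //; rewrite f1 -e1.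
- by rewrite -s; apply: not_tangent free => //; exact/enorm1P/dotp_unit_vec.
Qed.

(** A trajectory cannot land tangentially inside a side: it would run along that
side just before. *)
Lemma landing_not_tangent c m z j (tau : R) : 0 < tau ->
  open_side j (line c m z (htime c m z + tau)) ->
  (forall t, htime c m z < t < htime c m z + tau -> ~ bdry Q (line c m z t)) ->
  dotp (unfold_dir c m z) (normal j) != 0.
Proof.
move=> tau0 oj free.
have := @not_tangent j _ (- unfold_dir c m z) tau oj.
rewrite enormN (enorm1P (unfold_dirU c m z)) => /(_ erefl tau0).
have -> : dotp (- unfold_dir c m z) (normal j) = - dotp (unfold_dir c m z) (normal j).
  by rewrite -scaleN1r (dotpZl (-1)) mulN1r.
rewrite oppr_eq0; apply => t /andP[t0 t1].
have -> : line c m z (htime c m z + tau) + t *: - unfold_dir c m z =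
  line c m z (htime c m z + tau - t).
  by rewrite [RHS]lineD scalerN scaleNr.
by apply: free; lra.
Qed.

Lemma itin_extend c m z j (tau : R) : itin c m z -> 0 < tau ->
  open_side j (line c m z (htime c m z + tau)) ->
  (forall t, htime c m z < t < htime c m z + tau -> ~ bdry Q (line c m z t)) ->
  dotp (unfold_dir c m z) (normal j) < 0 ->
  exists c', [/\ forall k, (k <= m)%N -> c' k = c k, c' m.+1 = j, itin c' m.+1 z
    & htime c' m.+1 z = htime c m z + tau].
Proof.
move=> h tau0 oj free neg.
pose c' k := if (k <= m)%N then c k else j.
have cc k : (k <= m)%N -> c' k = c k by rewrite /c' => ->.
have cS : c' m.+1 = j by rewrite /c' ltnn.
have hl : line c' m z = line c m z by exact: lineE_ext.
have hdir : unfold_dir c' m z = unfold_dir c m z by have [] := line_ext z cc.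
have hpos : unfold_pos c' m z = unfold_pos c m z by have [] := line_ext z cc.
have ht : htime c' m z = htime c m z by exact: htime_ext.
have htS : htime c' m.+1 z = htime c m z + tau.
  rewrite /= cS hdir hpos; have [+ _] := oj; rewrite height_line => /eqP.
  by rewrite addr_eq0 => /eqP ->; rewrite opprK mulfK // lt_eqF.
have ic : itin c' m z by apply: itin_ext h => k km; rewrite cc.
have fl : flight c' m z.
  split; rewrite ?htS ?ht ?hdir ?cS ?hl ?cc //.
  - by rewrite ltrDl.
  - by case: oj.
  - move=> k km kj s /andP[s0 s1].
    rewrite (_ : _ - _ = tau); last by rewrite addrC addKr.
    move=> sk.
    have os : open_side (c m) (line c m z (htime c m z)) by exact: itin_open.
    have [s0'|s0'] := eqVneq s 0.
      move: sk; rewrite s0' mul0r addr0 => /(open_side_uniq os) ek.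
      by rewrite ek eqxx in km.
    have [s1'|s1'] := eqVneq s 1.
      move: sk; rewrite s1' mul1r => /(open_side_uniq oj) ek.
      by rewrite ek eqxx in kj.
    apply: (free (htime c m z + s * tau)); last by apply/bdryP; exists k.
    have sp : 0 < s by rewrite lt_neqAle eq_sym s0'.
    have s1p : s < 1 by rewrite lt_neqAle s1'.
    by rewrite ltrDl ltrD2l mulr_gt0 //= gtr_pMl.
exists c'; split => //.
case: ic => h0 h1 h2; split=> // k; rewrite ltnS leq_eqVlt => /orP[/eqP -> //|].
exact: h2.
Qed.

(** The formal definition of the billiard map asks only that the image be in the
phase space. Transversality of the landing follows: the reflected vector points
into the region, and tangency is excluded by [landing_not_tangent]. *)
Lemma step_extend c m z (tau : R) z' : itin c m z ->
  billiard_step Q (coords c m z) tau z' ->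
  exists c', [/\ forall k, (k <= m)%N -> c' k = c k, itin c' m.+1 z,
    z' = coords c' m.+1 z & tau = htime c' m.+1 z - htime c' m z].
Proof.
move=> h [_ hz' tau0 [i [j [p [p' [[hi hj] [hp hp'] e free er]]]]]].
have hm := coords_in_open_side h.
have ei : i = c m by apply: in_open_side_uniq hi (in_open_sideW hm).
have [e1 e2] := vector_at_open hm hp; have [e1' e2'] := vector_at_open hj hp'.
rewrite coords_arc // in e1; rewrite (coords_angle h).2 in e2.
rewrite e1 e2 in e er free.
have {}e : p'.1 = line c m z (htime c m z + tau) by rewrite e lineD.
have oj : open_side j (line c m z (htime c m z + tau)).
  by rewrite -e e1'; apply/open_side_arc.
have free' t : htime c m z < t < htime c m z + tau -> ~ bdry Q (line c m z t).
  move=> /andP[t0 t1]; rewrite (lineB c m z (htime c m z)); apply: free.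
  by rewrite subr_gt0 t0 ltrBlDl.
have nt := landing_not_tangent tau0 oj free'.
have hd : dotp (unit_vec p'.2) (normal j) = - dotp (unfold_dir c m z) (normal j).
  by rewrite er reflect_dirE reflect_dir_normal.
have hs : dotp (unit_vec p'.2) (normal j) = sin z'.2.
  by rewrite e2' dotp_rotate_perp // side_dirU.
have neg : dotp (unfold_dir c m z) (normal j) < 0.
  rewrite lt_neqAle nt -oppr_ge0 -hd /=.
  have [_ [q hq inq]] := hz'; have [f1 f2] := vector_at_open hj hq.
  rewrite e2' -f2; apply: inward_dotp => //.
  by rewrite f1 -e1' e.
have t' : 0 < z'.2 < pi.
  apply: angle_transversal; first by case: hz'.
    by rewrite -hs hd oppr_ge0 ltW.
  by rewrite -hs hd oppr_eq0.
have [c' [cc cS ic htS]] := itin_extend h tau0 oj free' neg.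
exists c'; split => //; last by rewrite htS (htime_ext z cc) addrC addKr.
rewrite /coords lineS cS htS (lineE_ext z cc).
have -> : reflect_side j (line c m z (htime c m z + tau)) =
   line c m z (htime c m z + tau).
  by rewrite /reflect_side oj.1 mulr0 scale0r subr0.
rewrite -e e1' along_arc [side_start j + _]addrC subrK.
rewrite [LHS]surjective_pairing; congr pair.
rewrite /= cS (line_ext z cc).2 -reflect_dirE -er e2' dotp_rotate_id ?side_dirU //.
by case/andP: t' => /ltW ? /ltW ?; rewrite cosK // in_itv /=; apply/andP.
Qed.

Lemma itin_of_billiard_iter m z z' : billiard_iter Q m.+1 z z' ->
  exists2 c, itin c m.+1 z & z' = coords c m.+1 z.
Proof.
elim: m z' => [|m IH] z' [y hy [tau hs]].
  case: hy => _ ey; subst y; have [i hi hz] := step_transversal hs.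
  have h0 : itin (fun=> i) 0 z by split.
  rewrite -(coords0 (fun=> i) hz) in hs.
  by have [c [_ hc ez _]] := step_extend h0 hs; exists c.
have [c hc ey] := IH y hy; subst y.
by have [c' [_ hc' ez _]] := step_extend hc hs; exists c'.
Qed.

End Conversion.

(** * The flow with finitely many reflections *)

Section CappedFlow.
Context (R : realType) (Q : polygon R).
Implicit Types (i j : 'I_(nsides Q)) (p u w x z : R * R) (t : R) (k m : nat).
Implicit Types (c : nat -> 'I_(nsides Q)).

Lemma region_dist x y : region Q x -> region Q y -> enorm (x - y) <= diam Q.
Proof.
move=> rx ry; apply: ub_le_sup; last by exists x, y.
have [M [_ hM]] := compact_bounded (@poly_compact R Q).
have {}hM p : region Q p -> enorm p <= 2 * (`|M| + 1).
  move=> rp; have := hM (`|M| + 1) _ p rp; rewrite (le_lt_trans (ler_norm M)) ?ltrDl //.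
  move=> /(_ isT) /=; rewrite prod_normE /= ge_max => /andP[h1 h2].
  apply: (@le_trans _ _ (`|p.1| + `|p.2|)); last by lra.
  apply: enorm_le; first by rewrite addr_ge0.
  rewrite sqrrD !real_normK ?num_real // /dotp -!expr2.
  by rewrite -addrA lerD2l lerDr mulrn_wge0 // mulr_ge0.
exists (2 * (`|M| + 1) + 2 * (`|M| + 1)) => d [x' [y' [hx hy ->]]].
by apply: (le_trans (enormD _ _)); rewrite enormN lerD ?hM.
Qed.

Lemma bdry_open_side i x : open_side i x -> bdry Q x.
Proof. by move=> h; apply/bdryP; exists i; exact: open_sideW. Qed.

Lemma region_vertex i : region Q (vertex i).
Proof.
apply/bdry_region/bdryP; exists i; apply/sideP.
by rewrite along_vertex lexx /height subrr /dotp /= !mul0r addr0 ltW // side_len_gt0.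
Qed.

Lemma diam_gt0 : 0 < diam Q.
Proof.
have i : 'I_(nsides Q) by exists 0%N; apply: (leq_trans _ (poly_nsides Q)).
apply: lt_le_trans (side_len_gt0 i) _.
exact: region_dist (region_vertex _) (region_vertex _).
Qed.

(** A vector with positive normal component enters the region. *)
Lemma flight_region c m z (T : R) : itin c m z ->
  (forall s, htime c m z < s < T -> ~ bdry Q (line c m z s)) ->
  forall t, htime c m z <= t <= T -> region Q (line c m z t).
Proof.
move=> h free t /andP[t0 t1].
have oc := itin_open h.
have := @ray_region R Q (line c m z (htime c m z)) (unfold_dir c m z) (T - htime c m z)
  (bdry_region (bdry_open_side oc)) _ _ (t - htime c m z).
rewrite -lineB; apply; last by rewrite subr_ge0 t0 lerD2r.
  move=> s /andP[s0 sT]; rewrite -lineD; apply: free.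
  by rewrite ltrDl s0 -ltrBrDl.
have [rho rho0 hrho] := local_side oc.
exists rho => // s /andP[s0 sr].
have [|+ _ _ _] := hrho (s *: unfold_dir c m z); last first.
  by apply; rewrite (dotpZl s) mulr_gt0 // itin_out.
by rewrite enormZ (enorm1P (unfold_dirU c m z)) mulr1 gtr0_norm.
Qed.

Lemma line_speed c m z s t : enorm (line c m z t - line c m z s) = `|t - s|.
Proof.
by rewrite (lineB c m z s t) addrC addKr enormZ (enorm1P (unfold_dirU c m z)) mulr1.
Qed.

Lemma htime_diam c m z : itin c m z -> htime c m z <= m%:R * diam Q.
Proof.
elim: m => [|m IH] h; first by rewrite mul0r.
have hm := itinW (leqnSn m) h.
have T := htime_lt h.
have d : htime c m.+1 z - htime c m z <= diam Q.
  rewrite -[leLHS]gtr0_norm ?subr_gt0 // -(line_speed c m z).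
  by apply: region_dist; apply: (flight_region hm (flight_free h)); rewrite lexx ltW.
by rewrite -natr1 mulrDl mul1r; have := IH hm; lra.
Qed.

(** After [m0] reflections the point stops reflecting and goes on in a straight
line through the sides. The cap ensures that a trajectory can only break down at a
vertex reached by a last flight, since infinitely many reflections in a finite time
are ruled out by construction. *)
Definition at_time (m0 : nat) c m z t :=
  [/\ (m <= m0)%N, itin c m z, htime c m z <= t
    & m = m0 \/ forall s, htime c m z < s <= t -> ~ bdry Q (line c m z s)].

(** No vertex is met up to time [t], at least not before the [m0]-th reflection. *)
Definition alive (m0 : nat) z t := exists c m, at_time m0 c m z t.

Lemma at_time_le m0 c c' m m' z t : at_time m0 c m z t -> itin c' m' z ->
  (m' <= m0)%N -> htime c' m' z <= t -> (m' <= m)%N.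
Proof.
move=> [mm0 h ht free] h' m'm0 ht'; rewrite leqNgt; apply/negP => mm'.
case: free => [e|free]; first by move: m'm0; rewrite -e leqNgt mm'.
have hS := itinW mm' h'.
have E := itin_det h (itinW (ltnW mm') h').
apply: (free (htime c' m.+1 z)).
  by rewrite (htime_ext z E) htime_lt // (le_trans _ ht') // htime_le.
rewrite (lineE_ext z E); apply: bdry_open_side (flight_hit _).
by case: hS => _ _; apply.
Qed.

Lemma at_time_uniq m0 c c' m m' z t : at_time m0 c m z t ->
  at_time m0 c' m' z t -> m = m' /\ line c m z = line c' m' z.
Proof.
move=> h h'; have [mm0 hi ht _] := h; have [m'm0 hi' ht' _] := h'.
have e : m = m'.
  by apply/eqP; rewrite eqn_leq (at_time_le h hi') // (at_time_le h' hi).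
by subst m'; split=> //; apply: lineE_ext; exact: itin_det hi hi'.
Qed.

(** A neighbouring trajectory is in the same flight, unless [t] is the instant of
the last reflection; then the neighbour may be late and still be in the previous
flight. *)
Lemma near_at_time (T : Type) (F : set_system T) {FF : Filter F}
    (zf : T -> R * R) (tf : T -> R) m0 c m z t :
  zf x @[x --> F] --> z -> tf x @[x --> F] --> t -> at_time m0 c m z t ->
  \forall x \near F, 0 <= tf x -> at_time m0 c m (zf x) (tf x) \/
    [/\ (0 < m)%N, t = htime c m z & at_time m0 c m.-1 (zf x) (tf x)].
Proof.
move=> hz hT [mm0 h ht free].
have n1 : \forall x \near F, itin c m (zf x) by apply: (near_itin hz h).
have ct : htime c m (zf x) @[x --> F] --> htime c m z by exact: cvg_htime.
have n2 j : \forall x \near F, m != m0 -> j != c m -> forall s : R, 0 <= s <= 1 ->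
    ~ side j (line c m (zf x) (htime c m (zf x) + s * (tf x - htime c m (zf x)))).
  case: (boolP (m == m0)) => [/eqP e|nm]; first by near=> x.
  case: (boolP (j == c m)) => jm; first by near=> x.
  have H : forall s : R, 0 <= s <= 1 ->
      ~ side j (line c m z (htime c m z + s * (t - htime c m z))).
    move=> s /andP[s0 s1].
    have [e|ne] := eqVneq (s * (t - htime c m z)) 0.
      rewrite e addr0 => /(open_side_uniq (itin_open h)) ej.
      by rewrite ej eqxx in jm.
    move=> sj; case: free => [e|free]; first by rewrite e eqxx in nm.
    apply: (free (htime c m z + s * (t - htime c m z))); last by apply/bdryP; exists j.
    have p : 0 <= s * (t - htime c m z) by rewrite mulr_ge0 // subr_ge0.
    rewrite ltrDl lt_neqAle eq_sym ne p /= -lerBrDl.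
    by rewrite ler_piMl // subr_ge0.
  by near=> x => _ _; near: x; exact: near_line_not_side hz ct hT H.
have n3 : \forall x \near F, htime c m z < t -> htime c m (zf x) < tf x.
  have [lt|ge] := ltP (htime c m z) t; last by near=> x.
  by near=> x => _; near: x; exact: cvg_lt2 ct hT lt.
have n4 : \forall x \near F, (0 < m)%N -> htime c m.-1 (zf x) < tf x.
  case: m mm0 h ht {free n1 ct n2 n3} => [|m] mm0 h ht; first by near=> x.
  have ct' : htime c m (zf x) @[x --> F] --> htime c m z.
    by apply: cvg_htime => //; exact: itinW h.
  have lt : htime c m z < t by apply: lt_le_trans ht; exact: htime_lt.
  by near=> x => _; near: x; exact: cvg_lt2 ct' hT lt.
near=> x => tx0.
have i1 : itin c m (zf x) by near: x; exact: n1.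
have i2 : forall j, m != m0 -> j != c m -> forall s : R, 0 <= s <= 1 ->
    ~ side j (line c m (zf x) (htime c m (zf x) + s * (tf x - htime c m (zf x)))).
  by near: x; exact: filter_forall n2.
have i3 : htime c m z < t -> htime c m (zf x) < tf x by near: x; exact: n3.
have i4 : (0 < m)%N -> htime c m.-1 (zf x) < tf x by near: x; exact: n4.
have [le|lt] := leP (htime c m (zf x)) (tf x).
  left; split=> //; have [->|nm] := eqVneq m m0; [by left|right].
  move=> s /andP[s0 s1] /bdryP[j].
  have [->|jm] := eqVneq j (c m).
    move=> /sideP[+ _]; rewrite (lineB c m (zf x) (htime c m (zf x))) heightD.
    have [-> _] := itin_open i1; rewrite add0r (dotpZl (s - _)).
    have o := itin_out i1 => h2.
    have : 0 < (s - htime c m (zf x)) * dotp (unfold_dir c m (zf x)) (normal (c m)).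
      by rewrite mulr_gt0 // subr_gt0.
    by rewrite h2 ltxx.
  have := i2 j nm jm ((s - htime c m (zf x)) / (tf x - htime c m (zf x))).
  have p : 0 < tf x - htime c m (zf x) by rewrite subr_gt0 (lt_le_trans s0).
  rewrite divfK ?gt_eqF // [_ + (s - _)]addrC subrK; apply.
  rewrite divr_ge0 ?(ltW p) ?subr_ge0 ?(ltW s0) //= ler_pdivrMr // mul1r.
  by rewrite lerD2r.
have e : t = htime c m z.
  by apply/le_anti; rewrite ht andbT leNgt; apply/negP => /i3; rewrite ltNge ltW.
have mp : (0 < m)%N.
  by case: (m) lt => // /lt_le_trans /(_ tx0); rewrite /= ltxx.
right; split=> //.
have {}i4 := i4 mp; move: mp i4 i1 lt mm0; case: (m) => // k _ i4 i1 lt mm0.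
split; [exact: ltnW|exact: itinW i1|exact: ltW|right].
move=> s /andP[s0 s1]; apply: (flight_free i1).
by rewrite s0 (le_lt_trans s1).
Unshelve. all: by end_near.
Qed.

(** A last flight that ends inside a side could be continued by a reflection, and
one that ends off the boundary would not have ended. *)
Lemma alive_limit m0 z t : 0 < t -> (forall s, 0 <= s < t -> alive m0 z s) ->
  ~ alive m0 z t -> exists c m v,
  [/\ itin c m z, htime c m z < t, line c m z t = vertex (p := Q) v
    & forall s, htime c m z < s < t -> at_time m0 c m z s].
Proof.
move=> t0 al nal.
pose P k := `[< (k <= m0)%N /\ exists2 c : nat -> 'I_(nsides Q), itin c k z & htime c k z < t >].
have P0 : P 0%N.
  apply/asboolP; split=> //; have [|c [k [_ h _ _]]] := al 0; first by rewrite lexx.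
  by exists c => //; exact: itinW h.
have Pm0 (k : nat) : P k -> (k <= m0)%N by move=> /asboolP[].
have exP : exists k, P k by exists 0%N.
case: (ex_maxnP exP Pm0) => m /asboolP[mm0 [c hc ht]] maxm.
have nm : m != m0.
  by apply/eqP => e; apply: nal; exists c, m; split=> //; [exact: ltW|left].
have at_s s : htime c m z < s < t -> at_time m0 c m z s.
  move=> /andP[s0 s1]; have s_ge0 : 0 <= s.
    by apply: le_trans (ltW s0); apply: (htime_le hc (leq0n m)).
  have [|c' [m' h']] := al s; first by rewrite s_ge0.
  have [m'm0 hc' ht' free'] := h'.
  have e : m' = m.
    apply/eqP; rewrite eqn_leq (at_time_le h' hc) ?ltW // andbT.
    by apply: maxm; apply/asboolP; split=> //; exists c' => //; exact: le_lt_trans s1.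
  subst m'; have E := itin_det hc' hc.
  by split; rewrite // -?(lineE_ext z E) -?(htime_ext z E).
have free s : htime c m z < s < t -> ~ bdry Q (line c m z s).
  move=> hs; have [_ _ _ [e|]] := at_s s hs; first by rewrite e eqxx in nm.
  by apply; case/andP: hs => -> _ /=.
have : bdry Q (line c m z t).
  apply: contrapT => nb; apply: nal; exists c, m; split=> //; [exact: ltW|right].
  move=> s /andP[s0]; rewrite le_eqVlt => /orP[/eqP -> //|s1].
  by apply: free; rewrite s0.
move=> /bdryP[j] /side_vertexP[oj|[v hv]]; last by exists c, m, v; split.
case: nal.
have tau0 : 0 < t - htime c m z by rewrite subr_gt0.
have et : htime c m z + (t - htime c m z) = t by rewrite addrC subrK.
have := @landing_not_tangent _ _ c m z j (t - htime c m z) tau0.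
have := @itin_extend _ _ c m z j (t - htime c m z) hc tau0.
rewrite et => /(_ oj free) ext /(_ oj free) nt.
(* The flight stays in the region, so it arrives from the left of the side [j]. *)
have neg : dotp (unfold_dir c m z) (normal j) < 0.
  rewrite lt_neqAle nt /= leNgt; apply/negP => pos.
  have [rho rho0 hrho] := local_side oj.
  pose d := Num.min (t - htime c m z) rho / 2.
  have m1 : 0 < Num.min (t - htime c m z) rho by rewrite lt_min tau0.
  have me : Num.min (t - htime c m z) rho <= t - htime c m z by rewrite ge_min lexx.
  have mr : Num.min (t - htime c m z) rho <= rho by rewrite ge_min lexx orbT.
  have d0 : 0 < d by rewrite divr_gt0.
  have [|_ + _ _] := hrho (- d *: unfold_dir c m z).
    by rewrite enormZ (enorm1P (unfold_dirU c m z)) mulr1 normrN gtr0_norm // /d; lra.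
  apply; first by rewrite (dotpZl (- d)) mulNr oppr_lt0 mulr_gt0.
  rewrite -lineD; apply: (flight_region hc free).
  by apply/andP; split; rewrite /d; lra.
have [c' [_ _ ic' ht']] := ext neg.
exists c', m.+1; split=> //; first by rewrite ltn_neqAle nm.
  by rewrite ht'.
by right => s; rewrite ht' => /andP[/lt_le_trans h1 /h1]; rewrite ltxx.
Qed.

End CappedFlow.

(** * Perturbation of a trajectory that avoids the vertices *)

Section Perturbation.
Context (R : realType) (Q : polygon R).
Implicit Types (i j v : 'I_(nsides Q)) (z : R * R) (t l : R) (k m : nat).
Implicit Types (c : nat -> 'I_(nsides Q)).

Lemma line0_dist c z z' t : 0 <= t ->
  enorm (line c 0 z' t - line c 0 z t) <= `|z'.1 - z.1| + t * `|z'.2 - z.2|.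
Proof.
move=> t0; have eU := side_dirU (c 0%N).
have -> : line c 0 z' t - line c 0 z t = (z'.1 - z.1) *: side_dir (c 0%N) +
    t *: (rotate z'.2 (side_dir (c 0%N)) - rotate z.2 (side_dir (c 0%N))).
  rewrite /line /= /arc_point scalerBr opprD addrACA; congr (_ + _).
  by rewrite opprD addrACA subrr add0r -scalerBl opprB addrA subrK.
apply: (le_trans (enormD _ _)); rewrite (enormZ (_ - _)) (enormZ t) (enorm1P eU) mulr1 lerD2l.
by rewrite (ger0_norm t0) ler_wpM2l // rotate_lip.
Qed.

Section Path.
Context (m0 : nat) (z0 z1 : R * R).
Let zl l := z0 + l *: (z1 - z0).
Let L t := `|z1.1 - z0.1| + t * `|z1.2 - z0.2|.

Let zl0 : zl 0 = z0.
Proof. by rewrite /zl scale0r addr0. Qed.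

Let zl_dist c l l' t : 0 <= t ->
  enorm (line c 0 (zl l') t - line c 0 (zl l) t) <= L t * `|l' - l|.
Proof.
move=> t0; apply: (le_trans (line0_dist c _ _ t0)).
rewrite /zl /= /GRing.scale /=.
rewrite (_ : z0.1 + l' * (z1.1 - z0.1) - _ = (l' - l) * (z1.1 - z0.1)); last by ring.
rewrite (_ : z0.2 + l' * (z1.2 - z0.2) - _ = (l' - l) * (z1.2 - z0.2)); last by ring.
by rewrite !normrM /L; lra.
Qed.

(** At an instant of reflection the two descriptions of the position, before and
after the reflection, agree; so the position of [z_l] can always be compared with
that of a neighbour through a single code. *)
Lemma flow_lipschitz t : 0 <= t ->
  (forall l, 0 <= l <= 1 -> alive Q m0 (zl l) t) ->
  forall l c m c0 k0, 0 <= l <= 1 -> at_time (Q := Q) m0 c m (zl l) t ->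
    at_time (Q := Q) m0 c0 k0 z0 t ->
    enorm (line c m (zl l) t - line c0 k0 z0 t) <= L t * l.
Proof.
move=> t0 al.
pose pos l X := exists c m, at_time (Q := Q) m0 c m (zl l) t /\ X = line c m (zl l) t.
have pos_uniq l X Y : pos l X -> pos l Y -> X = Y.
  move=> [c [m [h ->]]] [c' [m' [h' ->]]].
  by have [_ ->] := at_time_uniq h h'.
pose f l : R * R := xget 0 [set X | pos l X].
have fE l X : pos l X -> f l = X.
  by move=> h; apply: (pos_uniq l) => //; exact: (@xgetPex _ 0 _ (ex_intro _ X h)).
have lip : forall l : R, 0 <= l <= 1 -> \forall m \near l, 0 <= m <= 1 ->
    enorm (f m - f l) <= L t * `|m - l|.
  move=> l l01; have [c [m h]] := al l l01.
  have hz : zl x @[x --> l] --> zl l by exact: ray_cvg.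
  have hT : (fun=> t) x @[x --> l] --> t by exact: cvg_cst.
  near=> x => _.
  have : 0 <= t -> at_time m0 c m (zl x) t \/
    [/\ (0 < m)%N, t = htime c m (zl l) & at_time m0 c m.-1 (zl x) t].
    by near: x; exact: near_at_time hz hT h.
  have -> : f l = line c m (zl l) t by apply: fE; exists c, m.
  case/(_ t0) => [h'|[m_gt0 e h']].
    have -> : f x = line c m (zl x) t by apply: fE; exists c, m.
    by rewrite line_dist; exact: zl_dist.
  have -> : f x = line c m.-1 (zl x) t by apply: fE; exists c, m.-1.
  have hi : itin c m (zl l) := let: And4 _ hi _ _ := h in hi.
  move: m_gt0 e hi; case: (m) => // k _ e hi /=.
  rewrite e line_hit; last first.
    by case: hi => _ _ /(_ _ (ltnSn k)) [_ + _ _]; rewrite lt_neqAle => /andP[].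
  by rewrite -e line_dist; exact: zl_dist.
move=> l c m c0 k0 l01 h h0.
have <- : f l = line c m (zl l) t by apply: fE; exists c, m.
have <- : f 0 = line c0 k0 z0 t by apply: fE; exists c0, k0; rewrite zl0.
exact: lipschitz_of_local lip l l01.
Unshelve. all: by end_near.
Qed.

(** Induction on the time, for all [l] at once. The step to later times uses the
compactness of [[0, 1]]. At a limit time a trajectory that breaks down approaches a
vertex, to which [z0] is then closer than [a]. *)
Lemma perturbation_alive i (a T : R) :
  in_open_side i z0.1 -> in_open_side i z1.1 ->
  0 < z0.2 < pi -> 0 < z1.2 < pi -> 0 <= T ->
  (forall t c k v, 0 <= t <= T -> at_time (Q := Q) m0 c k z0 t ->
     a <= enorm (line c k z0 t - vertex v)) ->
  L T < a ->
  forall t, 0 <= t <= T -> forall l, 0 <= l <= 1 -> alive Q m0 (zl l) t.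
Proof.
move=> /andP[i0 i0'] /andP[i1 i1'] /andP[t0 t0'] /andP[t1 t1'] T0 far LT.
have Lge t : 0 <= t <= T -> L t <= L T.
  by move=> /andP[_ tT]; rewrite lerD2l ler_wpM2r.
apply: real_induction.
- move=> l /andP[l0 l1]; exists (fun=> i), 0%N; split=> //; last first.
    by right => s /andP[/= s0 s0']; have := lt_le_trans s0 s0'; rewrite ltxx.
  split=> //=; rewrite /in_open_side /zl /= /GRing.scale /=.
    apply/andP; split.
      by rewrite -ltrN2; have := @convex_lt R (- z0.1) (- z1.1) (- side_start i) l;
         rewrite l0 l1 !ltrN2 => /(_ isT i0 i1); lra.
    by have := @convex_lt R _ _ (side_start i + side_len i) l _ i0' i1';
       rewrite l0 l1 => /(_ isT); lra.
  apply/andP; split.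
    by rewrite -ltrN2; have := @convex_lt R (- z0.2) (- z1.2) (- 0) l;
       rewrite l0 l1 !ltrN2 => /(_ isT t0 t1); lra.
  by have := @convex_lt R _ _ pi l _ t0' t1'; rewrite l0 l1 => /(_ isT); lra.
- move=> t /andP[t_ge0 tT] al.
  have := @segment_compact R 0 1 => /compact_near_coveringP cov.
  have := cov R (nbhs t) (fun s l => t < s -> alive Q m0 (zl l) s) _.
  move=> H; have {}H : \forall s \near t,
      `[0, 1]%classic `<=` (fun l => t < s -> alive Q m0 (zl l) s).
    apply: H => l /=; rewrite in_itv /= => l01.
    have [c [m h]] := al t (andb_true_intro (conj t_ge0 (lexx t))) l l01.
    have hz : zl x.1 @[x --> filter_prod (nbhs l) (nbhs t)] --> zl l.
      by apply: (cvg_comp _ _ cvg_fst); exact: ray_cvg.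
    have hT : x.2 @[x --> filter_prod (nbhs l) (nbhs t)] --> t by exact: cvg_snd.
    suff : filter_prod (nbhs l) (nbhs t) [set x | t < x.2 -> alive Q m0 (zl x.1) x.2] by [].
    apply: filterS (near_at_time hz hT h) => x hx /= tx.
    by case: (hx (le_trans t_ge0 (ltW tx))) => [h2|[_ _ h2]]; [exists c, m|exists c, m.-1].
  by apply: filterS H => s hs ts l l01; apply: hs => //=; rewrite in_itv.
- move=> t /andP[t_gt0 tT] al l l01; apply: contrapT => nal.
  have [|c [m [v [hi ht hv hat]]]] := alive_limit t_gt0 _ nal.
    by move=> s hs; exact: al.
  have lt0 : L T < a by [].
  pose s := Num.max (htime c m (zl l)) (t - (a - L T)).
  have st' : s < t by rewrite gt_max ht /=; lra.
  pose r := (s + t) / 2.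
  have r1 : htime c m (zl l) < r.
    have : htime c m (zl l) <= s by rewrite le_max lexx.
    by rewrite /r; lra.
  have r2 : t - r < a - L T.
    have : t - (a - L T) <= s by rewrite le_max lexx orbT.
    by rewrite /r; lra.
  have r3 : r < t by rewrite /r; lra.
  have r0 : 0 <= r by apply: (le_trans _ (ltW r1)); exact: htime_le hi (leq0n m).
  have alr : forall l, 0 <= l <= 1 -> alive Q m0 (zl l) r by apply: al; rewrite r0.
  have [c0 [k0 h0]] := alr 0 (andb_true_intro (conj (lexx 0) ler01)).
  rewrite zl0 in h0.
  have hr : at_time m0 c m (zl l) r by apply: hat; rewrite r1.
  have h1 := flow_lipschitz r0 alr l01 hr h0.
  have h2 : a <= enorm (line c0 k0 z0 r - vertex v).
    by apply: far => //; rewrite r0 (le_trans (ltW r3)).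
  have h3 : enorm (line c m (zl l) r - vertex v) = t - r.
    by rewrite -hv line_speed ltr0_norm ?opprB // subr_lt0.
  have h4 := enorm_lip (line c0 k0 z0 r) (line c m (zl l) r) (vertex v).
  have h5 : L r * l <= L T.
    have L0 : 0 <= L r by rewrite addr_ge0 // mulr_ge0.
    case/andP: l01 => l0 l1; apply: (le_trans (ler_piMr L0 l1)); apply: Lge.
    by rewrite r0 (le_trans (ltW r3)).
  rewrite enormBC in h1.
  by lra.
Qed.

End Path.

(** Each of the first [m] flights, and the current one, last at most [diam Q]. *)
Lemma alive_many m0 (n : nat) c m z : (n <= m0)%N ->
  at_time (Q := Q) m0 c m z (1 + n%:R * diam Q) -> (n <= m)%N.
Proof.
move=> nm0 [mm0 hi ht [->//|free]]; rewrite leqNgt; apply/negP => mn.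
set T := 1 + _ in ht free.
have f s : htime c m z < s < T -> ~ bdry Q (line c m z s).
  by move=> /andP[s0 s1]; apply: free; rewrite s0 ltW.
have h : T - htime c m z <= diam Q.
  rewrite -[leLHS]ger0_norm ?subr_ge0 // -(line_speed c m z).
  by apply: region_dist; apply: (flight_region hi f); rewrite lexx ht.
have h1 := htime_diam hi.
have h2 : m.+1%:R * diam Q <= n%:R * diam Q.
  by rewrite ler_wpM2r ?(ltW (diam_gt0 Q)) // ler_nat.
by move: h2; rewrite -natr1 mulrDl mul1r /T in h *; lra.
Qed.

Definition far_from_vertices (a T : R) c m z := forall k t v, (k < m)%N ->
  htime c k z <= t <= htime c k.+1 z -> t <= T ->
  a <= enorm (line c k z t - vertex v).

(** Along the path from [z0] to [z1] at least [n] reflections happen by time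
[1 + n * diam Q]. The code of the first [n] of them is locally constant by
[near_itin] and [itin_det]. *)
Lemma same_itinerary c (n m0 : nat) (a : R) z0 z1 :
  itin c m0 z0 -> 1 + n%:R * diam Q < htime c m0 z0 ->
  far_from_vertices a (1 + n%:R * diam Q) c m0 z0 ->
  in_open_side (c 0%N) z1.1 -> 0 < z1.2 < pi ->
  `|z1.1 - z0.1| + (1 + n%:R * diam Q) * `|z1.2 - z0.2| < a ->
  itin c n z1.
Proof.
set T := 1 + _ => h0 hT far i1 t1 LT.
have T0 : 0 <= T by rewrite addr_ge0 // mulr_ge0 // ltW // diam_gt0.
have nm0 : (n <= m0)%N.
  rewrite leqNgt; apply/negP => mn.
  have := htime_diam h0.
  have : m0%:R * diam Q <= n%:R * diam Q.
    by rewrite ler_wpM2r ?(ltW (diam_gt0 Q)) // ler_nat ltnW.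
  by move: hT; rewrite /T; lra.
have [i0 t0 _] := h0.
have far' t c' k v : 0 <= t <= T -> at_time m0 c' k z0 t ->
     a <= enorm (line c' k z0 t - vertex v).
  move=> /andP[t_ge0 tT] h; have [km0 hk ht free] := h.
  have E := itin_det hk (itinW km0 h0).
  have lt : (k < m0)%N.
    rewrite ltn_neqAle km0 andbT; apply/eqP => e; subst k.
    by move: ht; rewrite (htime_ext z0 E) leNgt (le_lt_trans tT).
  rewrite (lineE_ext z0 E); apply: far => //.
  rewrite -(htime_ext z0 E) ht /=; rewrite leNgt; apply/negP => gt.
  by have := at_time_le h (itinW lt h0) lt (ltW gt); rewrite ltnn.
have al := perturbation_alive i0 i1 t0 t1 T0 far' LT.
have alT := al T (andb_true_intro (conj T0 (lexx T))).
have h1 : forall l, 0 <= l <= 1 -> exists c', itin c' n (z0 + l *: (z1 - z0)).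
  move=> l /alT [c' [m h]]; exists c'.
  by have nm := alive_many nm0 h; case: h => _ h _ _; exact: itinW h.
have : forall l, 0 <= l <= 1 -> itin c n (z0 + l *: (z1 - z0)).
  apply: real_induction.
  - by rewrite scale0r addr0; exact: itinW h0.
  - move=> l /andP[l0 l1] IH.
    have hl := IH l (andb_true_intro (conj l0 (lexx l))).
    have hz := @ray_cvg R z0 (z1 - z0) l.
    by near=> s => _; near: s; exact: near_itin hz hl.
  - move=> l /andP[l0 l1] IH.
    have [|c' hc'] := h1 l; first by rewrite ltW.
    have hz := @ray_cvg R z0 (z1 - z0) l.
    have /nbhs_ballP[e /= e0 he] : \forall s \near l, itin c' n (z0 + s *: (z1 - z0)).
      exact: near_itin hz hc'.
    pose s := Num.max 0 (l - e / 2).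
    have s0 : 0 <= s by rewrite le_max lexx.
    have sl : s < l by rewrite gt_max l0 /=; lra.
    have se : l - e / 2 <= s by rewrite le_max lexx orbT.
    have hs' : itin c' n (z0 + s *: (z1 - z0)).
      by apply: he; rewrite /ball /= gtr0_norm ?subr_gt0 //; lra.
    have hs : itin c n (z0 + s *: (z1 - z0)) by apply: IH; rewrite s0.
    by apply: itin_ext hc' => k kn; apply: itin_det hs' hs _ kn.
move=> /(_ 1); rewrite scale1r addrC subrK; apply.
by rewrite ler01 lexx.
Unshelve. all: by end_near.
Qed.

End Perturbation.

(** * Borel sets of the plane *)

Section PlaneMeasurable.
Context (R : realType).
Let mR := measurableTypeR R.

Definition rat_box (q : rat * rat * rat * rat) : set (R * R) :=
  `]ratr q.1.1.1, ratr q.1.1.2[%classic `*` `]ratr q.1.2, ratr q.2[%classic.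

Lemma rat_box_nbhs (U : set (R * R)) (z : R * R) : nbhs z U ->
  exists q, rat_box q z /\ rat_box q `<=` U.
Proof.
move=> /nbhs_ballP[e /= e0 he].
have lt (x : R) : x - e < x /\ x < x + e by lra.
have /rat_in_itvoo[q1] := (lt z.1).1; have /rat_in_itvoo[q2] := (lt z.1).2.
have /rat_in_itvoo[q3] := (lt z.2).1; have /rat_in_itvoo[q4] := (lt z.2).2.
rewrite !in_itv /= => /andP[h4 h4'] /andP[h3 h3'] /andP[h2 h2'] /andP[h1 h1'].
exists (q1, q2, q3, q4); split; first by split; rewrite /= in_itv /=; apply/andP.
move=> y [/=]; rewrite !in_itv /= => /andP[y1 y1'] /andP[y2 y2']; apply: he.
by split; rewrite /ball /= ltr_norml; apply/andP; split; lra.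
Qed.

Lemma measurable_rat_box q : measurable (rat_box q : set (mR * mR)).
Proof. by apply: measurableX; exact: measurable_itv. Qed.

Lemma open_measurable_plane (U : set (R * R)) : open U ->
  measurable (U : set (mR * mR)).
Proof.
move=> oU.
have -> : U = \bigcup_(q in [set: rat * rat * rat * rat])
    (if `[< rat_box q `<=` U >] then rat_box q else set0).
  apply/seteqP; split=> z.
    move=> Uz; have [q [qz qU]] := rat_box_nbhs (open_nbhs_nbhs (conj oU Uz)).
    by exists q => //; case: asboolP.
  by move=> [q _]; case: asboolP => // qU; exact: qU.
apply: countable_bigcupT_measurable; first exact: countableP.
by move=> q; case: ifP => _; [exact: measurable_rat_box|exact: measurable0].
Qed.

(** The preimage of an open half line is open in [D]. *)
Lemma local_measurable (D : set (R * R)) (f : R * R -> R) : open D ->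
  (forall z, D z -> f x @[x --> z] --> f z) ->
  measurable_fun (D : set (mR * mR)) (f : _ -> mR).
Proof.
move=> oD cf; apply: (measurability _ (RGenOInfty.measurableE R)).
move=> _ [_ [a ->] <-]; apply: open_measurable_plane.
rewrite openE => z [Dz /=]; rewrite in_itv /= andbT => fz.
apply: filterI; first exact: open_nbhs_nbhs.
near=> x; rewrite /= in_itv /= andbT; near: x; exact: cvgr_gt (cf z Dz) _ fz.
Unshelve. all: by end_near.
Qed.

Lemma local_measurable_preimage (D : set (R * R)) (g : R * R -> R * R)
    (A : set (mR * mR)) : open D ->
  (forall z, D z -> g x @[x --> z] --> g z) -> measurable A ->
  measurable (D `&` g @^-1` A : set (mR * mR)).
Proof.
move=> oD cg mA.
suff : measurable_fun (D : set (mR * mR)) (g : _ -> (mR * mR)%type).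
  by move=> H; apply: H => //; exact: open_measurable_plane.
apply: (measurability _ (measurable_prod_measurableType _ _)).
move=> _ [_ [A1 mA1 [A2 mA2 <-]] <-].
have -> : D `&` g @^-1` (A1 `*` A2) =
  (D `&` (fst \o g) @^-1` A1) `&` (D `&` (snd \o g) @^-1` A2).
  by apply/seteqP; split=> z /=; [move=> [? []]|move=> [[? ?] [? ?]]].
apply: measurableI.
- apply: local_measurable => //; last exact: open_measurable_plane.
  by move=> z Dz; apply: cvg_pair1; exact: cg.
- apply: local_measurable => //; last exact: open_measurable_plane.
  by move=> z Dz; apply: cvg_pair2; exact: cg.
Qed.

End PlaneMeasurable.

(** * Measurability of the billiard map and of the singular neighbourhoods *)

Section BilliardMap.
Context (R : realType) (Q : polygon R).
Implicit Types (i j v : 'I_(nsides Q)) (z : R * R) (t : R) (k m : nat).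
Implicit Types (c : nat -> 'I_(nsides Q)) (A : set (R * R)) (q : (R * R) * R).
Let mR := measurableTypeR R.

Definition two_sides i j (k : nat) := if k is 0%N then i else j.

Lemma coords_ext c c' m z : (forall l, (l <= m)%N -> c l = c' l) -> coords c m z = coords c' m z.
Proof.
move=> h; rewrite /coords (lineE_ext z h) (htime_ext z h) (h m) //.
by have [_ ->] := line_ext z h.
Qed.

Lemma itin_two_sides c z : itin c 1 z ->
  [/\ itin (two_sides (c 0%N) (c 1%N)) 1 z, coords c 1 z = coords (two_sides (c 0%N) (c 1%N)) 1 z
    & htime c 1 z = htime (two_sides (c 0%N) (c 1%N)) 1 z].
Proof.
have h l : (l <= 1)%N -> c l = two_sides (c 0%N) (c 1%N) l by case: l => [|[|]].
move=> hi; split; [exact: itin_ext hi|exact: coords_ext|exact: htime_ext].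
Qed.

(** The domain of the billiard map is a finite union of the open sets of vectors
that fly from [i] to [j], and the map is continuous on each of them. *)
Lemma stepP z (tau : R) z' : billiard_step Q z tau z' <-> exists i j,
  [/\ itin (two_sides i j) 1 z, z' = coords (two_sides i j) 1 z & tau = htime (two_sides i j) 1 z].
Proof.
split=> [hs|[i [j [h -> ->]]]].
  have [i hi hz] := step_transversal hs.
  have h0 : itin (fun=> i) 0 z by split.
  rewrite -(coords0 (fun=> i) hz) in hs.
  have [c [_ hc -> ->]] := step_extend h0 hs; exists (c 0%N), (c 1%N).
  by have [h1 h2 h3] := itin_two_sides hc; split; rewrite // subr0.
have := itin_step h; rewrite subr0 coords0 //.
by case: h.
Qed.

Lemma open_itin c m : open [set z | itin c m z].
Proof.
rewrite openE => z h; have hz : x @[x --> z] --> z by exact: cvg_id.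
exact: near_itin hz h.
Qed.

Lemma cvg_coords c m z : itin c m z -> coords c m x @[x --> z] --> coords c m z.
Proof.
move=> h; have hz : x @[x --> z] --> z by exact: cvg_id.
apply: cvg_pairP => /=.
  apply: cvgD; first exact: cvg_cst.
  by apply: cvg_along; apply: cvg_line => //; exact: cvg_htime.
have hd : dotp (unfold_dir c m x) (side_dir (c m)) @[x --> z] -->
    dotp (unfold_dir c m z) (side_dir (c m)).
  by apply: cvg_dotp; [exact: cvg_unfold_dir|exact: cvg_cst].
apply: (cvg_comp _ _ hd); apply: continuous_acos.
have := dotp_frame (unfold_dir c m z) (unfold_dir c m z) (side_dirU (c m)).
rewrite unfold_dirU; have := itin_out h; rewrite /normal.
by set x := dotp _ _; set y := dotp _ _ => ? ?; apply/andP; split; nra.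
Qed.

Definition step_preimage A : set (R * R) :=
  [set z | exists tau z', billiard_step Q z tau z' /\ A z'].

Lemma step_preimageE A : step_preimage A = \bigcup_(ij in [set: 'I_(nsides Q) * 'I_(nsides Q)])
  ([set z | itin (two_sides ij.1 ij.2) 1 z] `&` coords (two_sides ij.1 ij.2) 1 @^-1` A).
Proof.
apply/seteqP; split=> z.
  by move=> [tau [z' [/stepP [i [j [h -> _]]] Az]]]; exists (i, j).
move=> [[i j] _ [/= h Az]]; exists (htime (two_sides i j) 1 z), (coords (two_sides i j) 1 z).
by split=> //; apply/stepP; exists i, j.
Qed.

Lemma measurable_step_preimage A : measurable (A : set (mR * mR)) ->
  measurable (step_preimage A : set (mR * mR)).
Proof.
move=> mA; rewrite step_preimageE; apply: countable_bigcupT_measurable; first exact: countableP.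
move=> [i j]; apply: local_measurable_preimage => //; first exact: open_itin.
by move=> z; exact: cvg_coords.
Qed.

Definition short_flight (delta : R) : set (R * R) :=
  [set z | exists tau z', billiard_step Q z tau z' /\ tau < delta].

Lemma open_short_flight (delta : R) : open (short_flight delta).
Proof.
rewrite openE => z [tau [z' [/stepP[i [j [h _ ->]]] lt]]].
have hz : x @[x --> z] --> z by exact: cvg_id.
have n1 : \forall x \near z, itin (two_sides i j) 1 x by exact: near_itin hz h.
have n2 : \forall x \near z, htime (two_sides i j) 1 x < delta.
  have ch : htime (two_sides i j) 1 x @[x --> z] --> htime (two_sides i j) 1 z by exact: cvg_htime.
  exact: (cvgr_lt _ ch _ lt).
near=> x; exists (htime (two_sides i j) 1 x), (coords (two_sides i j) 1 x); split.
  by apply/stepP; exists i, j; split=> //; near: x; exact: n1.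
by near: x; exact: n2.
Unshelve. all: by end_near.
Qed.

Lemma rho_triangle (x y : R * R) (s t : R) q :
  rho (x, s) q <= rho (y, t) q + enorm (x - y) + `|s - t|.
Proof.
rewrite /rho /=.
have := enorm_lip x y q.1; have := ler_distD t s q.2.
by lra.
Qed.

Lemma near_rho (T : Type) (F : set_system T) {FF : Filter F} (xf : T -> R * R)
    (tf : T -> R) (x : R * R) t q (a : R) :
  xf y @[y --> F] --> x -> tf y @[y --> F] --> t -> rho (x, t) q < a ->
  \forall y \near F, rho (xf y, tf y) q < a.
Proof.
move=> hx ht lt; have e0 : 0 < (a - rho (x, t) q) / 2 by rewrite divr_gt0 // subr_gt0.
have n1 : \forall y \near F, enorm (xf y - x) < (a - rho (x, t) q) / 2.
  exact: near_enorm.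
have n2 : \forall y \near F, `|t - tf y| < (a - rho (x, t) q) / 2.
  exact: (cvgr_dist_lt _ _ ht).
near=> y.
have h1 : enorm (xf y - x) < (a - rho (x, t) q) / 2 by near: y; exact: n1.
have h2 : `|t - tf y| < (a - rho (x, t) q) / 2 by near: y; exact: n2.
rewrite distrC in h2.
have := rho_triangle (xf y) x (tf y) t q; lra.
Unshelve. all: by end_near.
Qed.

Definition side_angle i : R := projT1 (cid2 (angle_exists (side_dirU i))).

Lemma side_angleP i : 0 <= side_angle i < 2 * pi /\ side_dir i = unit_vec (side_angle i).
Proof. by rewrite /side_angle; case: cid2. Qed.

(** The direction [psi] of a vector lies in [[0, 2 * pi[], so it is not a
continuous function of the coordinates: it jumps by [2 * pi] at the horizontal
direction [psi = 0]. This is why the singular neighbourhoods are cut into pieces according to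
the number of full turns [b] to subtract from [side_angle i + theta]. *)
Definition direction i (b : bool) z : R := side_angle i + z.2 - b%:R * (2 * pi).

Lemma unit_vec_direction i b z : unit_vec (direction i b z) = rotate z.2 (side_dir i).
Proof.
rewrite (side_angleP i).2 rotate_unit_vec /direction; case: b; last first.
  by rewrite mul0r subr0.
rewrite mul1r; set x := side_angle i + z.2.
rewrite [in RHS](_ : x = x - 2 * pi + pi + pi); last by lra.
by rewrite /unit_vec !cosDpi !sinDpi !opprK.
Qed.

Lemma vector_atE i z q : in_open_side i z.1 -> 0 < z.2 < pi ->
  vector_at Q z q <-> exists b, 0 <= direction i b z < 2 * pi /\
    q = (arc_point i z.1, direction i b z).
Proof.
move=> hi /andP[z0 z1]; split.
  move=> h; have [e1 e2] := vector_at_open hi h; have [hq _] := h.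
  have [/andP[a0 a1] _] := side_angleP i.
  have [b hb] : exists b, 0 <= direction i b z < 2 * pi.
    have [lt|ge] := ltP (side_angle i + z.2) (2 * pi).
      by exists false; rewrite /direction mul0r subr0 lt addr_ge0 // ltW.
    exists true; rewrite /direction mul1r; apply/andP; split; first by lra.
    by have := pi_gt0 R; lra.
  exists b; split=> //; rewrite [LHS]surjective_pairing e1; congr pair.
  by apply: unit_vec_inj => //; rewrite e2 unit_vec_direction.
move=> [b [hb ->]]; split=> //; exists i; split=> //=; first exact: in_open_sideW.
exact: unit_vec_direction.
Qed.

Lemma measurable_direction i b :
  measurable ([set z | 0 <= direction i b z < 2 * pi] : set (mR * mR)).
Proof.
pose I : set R := `[b%:R * (2 * pi) - side_angle i,
  2 * pi + b%:R * (2 * pi) - side_angle i[%classic.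
have -> : [set z | 0 <= direction i b z < 2 * pi] = setT `*` I.
  apply/seteqP; split=> z; rewrite /= /direction /I /= in_itv /=.
    by move=> /andP[h1 h2]; split=> //; apply/andP; split; lra.
  by move=> [_ /andP[h1 h2]]; apply/andP; split; lra.
by apply: measurableX; [exact: measurableT|exact: measurable_itv].
Qed.

Lemma cvg_direction i b z : direction i b x @[x --> z] --> direction i b z.
Proof.
apply: cvgB; last exact: cvg_cst.
apply: cvgD; first exact: cvg_cst.
by apply: cvg_pair2; exact: cvg_id.
Qed.

(** The defining condition of [near_singular] concerns the flight and, at its
last instant, the reflected vector, which is the launching vector of the next
flight. For a fixed number of turns each of the two conditions is open. *)
Definition start_near (a : R) i b : set (R * R) :=
  [set z | [/\ in_open_side i z.1, 0 < z.2 < pi &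
    exists2 q, flow_bdry Q q & rho (arc_point i z.1, direction i b z) q < a]].

Definition flight_near (a : R) i j b : set (R * R) :=
  [set z | itin (two_sides i j) 1 z /\ exists t q, [/\ 0 <= t < htime (two_sides i j) 1 z,
    flow_bdry Q q & rho (line (two_sides i j) 0 z t, direction i b z) q < a]].

Lemma open_start_near a i b : open (start_near a i b).
Proof.
rewrite openE => z [hi hz [q hq lt]].
have h0 : itin (fun=> i) 0 z by split.
have cz : x @[x --> z] --> z by exact: cvg_id.
have n1 : \forall x \near z, itin (fun=> i) 0 x by exact: near_itin cz h0.
have n2 : \forall x \near z, rho (line (fun=> i) 0 x 0, direction i b x) q < a.
  have hl : line (fun=> i) 0 x 0 @[x --> z] --> line (fun=> i) 0 z 0.
    by apply: cvg_line => //; exact: cvg_cst.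
  have lt' : rho (line (fun=> i) 0 z 0, direction i b z) q < a.
    by rewrite /line scale0r addr0.
  exact: (near_rho hl (cvg_direction (z := z)) lt').
near=> x.
have [h1 h2 _] : itin (fun=> i) 0 x by near: x; exact: n1.
split=> //; exists q => //.
have : rho (line (fun=> i) 0 x 0, direction i b x) q < a by near: x; exact: n2.
by rewrite /line scale0r addr0.
Unshelve. all: by end_near.
Qed.

Lemma open_flight_near a i j b : open (flight_near a i j b).
Proof.
rewrite openE => z [h [t [q [/andP[t0 t1] hq lt]]]].
have cz : x @[x --> z] --> z by exact: cvg_id.
have n1 : \forall x \near z, itin (two_sides i j) 1 x by exact: near_itin cz h.
have n2 : \forall x \near z, rho (line (two_sides i j) 0 x t, direction i b x) q < a.
  have hl : line (two_sides i j) 0 x t @[x --> z] --> line (two_sides i j) 0 z t.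
    by apply: cvg_line => //; exact: cvg_cst.
  exact: (near_rho hl (cvg_direction (z := z)) lt).
have n3 : \forall x \near z, t < htime (two_sides i j) 1 x.
  have ch : htime (two_sides i j) 1 x @[x --> z] --> htime (two_sides i j) 1 z by exact: cvg_htime.
  exact: (cvgr_gt _ ch _ t1).
near=> x; split; first by near: x; exact: n1.
exists t, q; split=> //; last by near: x; exact: n2.
by rewrite t0 /=; near: x; exact: n3.
Unshelve. all: by end_near.
Qed.

Lemma near_singularE a : near_singular Q a =
  \bigcup_(x in [set: 'I_(nsides Q) * 'I_(nsides Q) * bool])
    ([set z | 0 <= direction x.1.1 x.2 z < 2 * pi] `&` flight_near a x.1.1 x.1.2 x.2)
  `|` step_preimage (\bigcup_(x in [set: 'I_(nsides Q) * bool])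
    ([set z | 0 <= direction x.1 x.2 z < 2 * pi] `&` start_near a x.1 x.2)).
Proof.
apply/seteqP; split=> z.
- move=> [_ [t [q [q' [[tau [z' [p [hs hp ht]]]] hq' lt]]]]].
  have [i [j [hi ez et]]] := (stepP _ _ _).1 hs; have [h1 h2 _] := hi.
  case: ht => [[ht eq]|[et' hq]]; [left|right].
    have [b [hb ep]] := (vector_atE p h1 h2).1 hp.
    exists (i, j, b) => //; split=> //; split=> //; exists t, q'; split=> //.
      by rewrite -et.
    suff -> : (line (two_sides i j) 0 z t, direction i b z) = q by [].
    by rewrite eq ep /= unit_vec_direction.
  exists tau, z'; split=> //.
  have oz : in_open_side j z'.1 by rewrite ez; exact: (coords_in_open_side hi).
  have az : 0 < z'.2 < pi by rewrite ez; have [] := coords_angle hi.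
  have [b [hb eq]] := (vector_atE q oz az).1 hq.
  by exists (j, b) => //; split=> //; split=> //; exists q'; rewrite //= -eq.
- case=> [[[[i j] b] _ [/= hb [hi [t [q' [ht hq' lt]]]]]]|].
    have hs : billiard_step Q z (htime (two_sides i j) 1 z) (coords (two_sides i j) 1 z).
      by apply/stepP; exists i, j.
    have [h1 h2 _] := hi.
    split; first by case: hs.
    exists t, (line (two_sides i j) 0 z t, direction i b z), q'; split=> //.
    exists (htime (two_sides i j) 1 z), (coords (two_sides i j) 1 z), (arc_point i z.1, direction i b z).
    split=> //; first by apply/(vector_atE _ h1 h2); exists b.
    by left; split=> //; rewrite /= unit_vec_direction.
  move=> [tau [z' [hs [[j b] _ [/= hb [h1 h2 [q' hq' lt]]]]]]].
  split; first by case: hs.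
  exists tau, (arc_point j z'.1, direction j b z'), q'; split=> //.
  have [_ _ _ [i [j' [p [p' [_ [hp _] _ _ _]]]]]] := hs.
  exists tau, z', p; split=> //; right; split=> //.
  by apply/(vector_atE _ h1 h2); exists b.
Qed.

Lemma measurable_near_singular a : measurable (near_singular Q a : set (mR * mR)).
Proof.
rewrite near_singularE; apply: measurableU.
  apply: countable_bigcupT_measurable; first exact: countableP.
  move=> x; apply: measurableI; first exact: measurable_direction.
  by apply: open_measurable_plane; exact: open_flight_near.
apply: measurable_step_preimage; apply: countable_bigcupT_measurable; first exact: countableP.
move=> x; apply: measurableI; first exact: measurable_direction.
by apply: open_measurable_plane; exact: open_start_near.
Qed.

End BilliardMap.

(** * Distance of a flight from the singular set *)

Section Gap.
Context (R : realType) (Q : polygon R).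
Implicit Types (i j k v : 'I_(nsides Q)) (z : R * R) (t e : R) (m : nat).
Implicit Types (c : nat -> 'I_(nsides Q)) (q : (R * R) * R).

(** Compactness: translating the segment by a small vector keeps it off [C]. *)
Lemma closed_far c m z (C : set (R * R)) (a b : R) : closed C ->
  (forall s : R, 0 <= s <= 1 -> ~ C (line c m z (a + s * (b - a)))) ->
  \forall e \near 0^'+, forall s y, 0 <= s <= 1 -> C y ->
    e <= enorm (line c m z (a + s * (b - a)) - y).
Proof.
move=> cC avoid.
have : \forall d \near (0 : R * R), forall s : R, 0 <= s <= 1 ->
    ~ C (line c m z (a + s * (b - a)) + d).
  apply: (@near_seg_avoid R _ (nbhs (0 : R * R)) _ C
    (fun d s => line c m z (a + s * (b - a)) + d)
    (fun s => line c m z (a + s * (b - a)))) => // s _.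
  rewrite -[X in _ --> X]addr0; apply: cvgD; last exact: cvg_snd.
  apply: cvg_line; first exact: cvg_cst.
  apply: cvgD; first exact: cvg_cst.
  by apply: cvgM; [exact: cvg_fst|exact: cvg_cst].
move=> /nbhs_enorm[r r0 hr]; near=> e => s y s01 Cy.
have er : e <= r by near: e; exact: nbhs_right_ltW.
apply: (le_trans er); rewrite leNgt; apply/negP => lt.
apply: (hr (y - line c m z (a + s * (b - a))) _ s s01).
  by rewrite subr0 enormBC.
by rewrite addrC subrK.
Unshelve. all: by end_near.
Qed.

Lemma near_right_ge (x : R * R) : x != 0 -> \forall e \near (0 : R)^'+, e <= enorm x.
Proof.
move=> x0; apply: nbhs_right_ltW; rewrite lt_neqAle enorm_ge0 andbT eq_sym.
by apply: contraNneq x0 => /enorm_eq0 ->.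
Qed.

Lemma unit_vec_lip (s t : R) : enorm (unit_vec s - unit_vec t) <= `|s - t|.
Proof.
have h1 : dotp ((1, 0) : R * R) (1, 0) = 1 by rewrite /dotp /=; ring.
have E (x : R) : unit_vec x = rotate x (1, 0).
  by rewrite /rotate /unit_vec /=; congr pair; ring.
by rewrite !E; exact: rotate_lip.
Qed.

(** The singular vectors near a flight have their foot on a vertex, or are tangent
to a side. The first are far because the flight avoids the vertices. If the flight
is not parallel to the side, its direction differs from that of the second; if it is
parallel, the flight avoids the side. *)
Lemma singular_gap c m z (a b : R) :
  (forall s v, 0 <= s <= 1 -> line c m z (a + s * (b - a)) <> vertex v) ->
  (forall k, dotp (unfold_dir c m z) (normal k) = 0 ->
    forall s : R, 0 <= s <= 1 -> ~ side k (line c m z (a + s * (b - a)))) ->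
  \forall e \near (0 : R)^'+, forall s psi q, 0 <= s <= 1 ->
    unit_vec psi = unfold_dir c m z -> flow_bdry Q q ->
    e <= rho (line c m z (a + s * (b - a)), psi) q.
Proof.
move=> nv par.
have n1 v : \forall e \near (0 : R)^'+, forall s y, 0 <= s <= 1 -> [set vertex v] y ->
    e <= enorm (line c m z (a + s * (b - a)) - y).
  apply: closed_far; last by move=> s s01; exact: nv.
  by apply: accessible_closed_set1; apply: hausdorff_accessible; exact: norm_hausdorff.
have n2 k : \forall e \near (0 : R)^'+,
    dotp (unfold_dir c m z) (normal k) = 0 -> forall s y, 0 <= s <= 1 -> side k y ->
    e <= enorm (line c m z (a + s * (b - a)) - y).
  have [d0|dn0] := eqVneq (dotp (unfold_dir c m z) (normal k)) 0; last first.
    by near=> e => d0; rewrite d0 eqxx in dn0.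
  by near=> e => _; near: e; exact: closed_far (@closed_side _ _ k) (par k d0).
have n3 k : \forall e \near (0 : R)^'+,
    dotp (unfold_dir c m z) (normal k) != 0 -> e <= enorm (unfold_dir c m z - side_dir k) /\
    e <= enorm (unfold_dir c m z - - side_dir k).
  have [d0|dn0] := eqVneq (dotp (unfold_dir c m z) (normal k)) 0; first by near=> e.
  have h1 : unfold_dir c m z - side_dir k != 0.
    by apply: contraNneq dn0 => /eqP; rewrite subr_eq0 => /eqP ->; rewrite dotp_dir_normal.
  have h2 : unfold_dir c m z - - side_dir k != 0.
    apply: contraNneq dn0 => /eqP; rewrite subr_eq0 => /eqP ->.
    by rewrite -scaleN1r (dotpZl (-1)) dotp_dir_normal mulr0.
  by near=> e => _; split; near: e; exact: near_right_ge.
near=> e => s psi [y psi'] s01 epsi [_ sing].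
have e1 : forall v s y, 0 <= s <= 1 -> [set vertex v] y ->
    e <= enorm (line c m z (a + s * (b - a)) - y) by near: e; exact: filter_forall n1.
have e2 : forall k, dotp (unfold_dir c m z) (normal k) = 0 -> forall s y, 0 <= s <= 1 ->
    side k y -> e <= enorm (line c m z (a + s * (b - a)) - y).
  by near: e; exact: filter_forall n2.
have e3 : forall k, dotp (unfold_dir c m z) (normal k) != 0 ->
    e <= enorm (unfold_dir c m z - side_dir k) /\ e <= enorm (unfold_dir c m z - - side_dir k).
  by near: e; exact: filter_forall n3.
rewrite /rho /=; case: sing => [[v /= ->]|[k /= ky dir]].
  by apply: (le_trans (e1 v s _ s01 erefl)); rewrite lerDl.
have [d0|dn0] := eqVneq (dotp (unfold_dir c m z) (normal k)) 0.
  by apply: (le_trans (e2 k d0 s _ s01 ky)); rewrite lerDl.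
have [f1 f2] := e3 k dn0.
have := unit_vec_lip psi psi'; rewrite epsi => h.
have := enorm_ge0 (line c m z (a + s * (b - a)) - y).
by case: dir => dir; rewrite dir in h; lra.
Unshelve. all: by end_near.
Qed.

Lemma open_side_vertex i v : ~ open_side i (vertex v).
Proof.
move=> h; have sv : side v (vertex v).
  apply/sideP; rewrite along_vertex lexx /height subrr /dotp /= !mul0r addr0.
  by rewrite ltW // side_len_gt0.
have e := open_side_uniq h sv; subst i.
by move: h => [_]; rewrite along_vertex ltxx.
Qed.

(** The gap of the flight and that of the vector reflected at its end. *)
Lemma near_singular_vanish z : exists2 e : R, 0 < e & ~ near_singular Q e z.
Proof.
have [[tau [z' hs]]|ns] := pselect (exists tau z', billiard_step Q z tau z'); last first.
  by exists 1 => // -[_ [t [q [q' [[tau [z' [p [hs _ _]]]] _ _]]]]]; apply: ns; exists tau, z'.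
have [i [j [h _ _]]] := (stepP Q _ _ _).1 hs.
have T := htime_lt h.
have h0 := itinW (leqnSn 0) h.
have [i0 i1 hf] := h; have [_ dneg _ avoid] := hf 0%N isT.
set c := two_sides i j in h T h0 hf dneg avoid.
have out0 := itin_out h0; have out1 := itin_out h.
have n1 : \forall e \near (0 : R)^'+, forall s psi q, 0 <= s <= 1 ->
    unit_vec psi = unfold_dir c 0 z -> flow_bdry Q q ->
    e <= rho (line c 0 z (htime c 0 z + s * (htime c 1 z - htime c 0 z)), psi) q.
  apply: singular_gap.
    move=> s v /andP[s0 s1] ev.
    have [s0'|s0'] := eqVneq s 0.
      move: ev; rewrite s0' mul0r addr0 => ev.
      by have := itin_open h0; rewrite ev; exact: open_side_vertex.
    have [s1'|s1'] := eqVneq s 1.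
      move: ev; rewrite s1' mul1r addrC subrK => ev.
      by have := flight_hit (hf 0%N isT); rewrite ev; exact: open_side_vertex.
    have sp : 0 < s by rewrite lt_neqAle eq_sym s0'.
    have s1p : s < 1 by rewrite lt_neqAle s1'.
    have d0 : 0 < htime c 1 z - htime c 0 z by rewrite subr_gt0.
    apply: (flight_free h (t := htime c 0 z + s * (htime c 1 z - htime c 0 z))).
      by rewrite ltrDl mulr_gt0 //= -ltrBrDl gtr_pMl.
    rewrite ev; apply/bdryP; exists v; apply/sideP.
    by rewrite along_vertex lexx /height subrr /dotp /= !mul0r addr0 ltW // side_len_gt0.
  move=> k d0 s s01; apply: avoid => //.
    by apply/eqP => ek; move: out0; rewrite -ek d0 ltxx.
  by apply/eqP => ek; move: dneg; rewrite -ek d0 ltxx.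
have n2 : \forall e \near (0 : R)^'+, forall s psi q, 0 <= s <= 1 ->
    unit_vec psi = unfold_dir c 1 z -> flow_bdry Q q ->
    e <= rho (line c 1 z (htime c 1 z + s * (htime c 1 z - htime c 1 z)), psi) q.
  apply: singular_gap.
    move=> s v _; rewrite subrr mulr0 addr0 => ev.
    by have := itin_open h; rewrite ev; exact: open_side_vertex.
  move=> k d0 s _; rewrite subrr mulr0 addr0 => /(open_side_uniq (itin_open h)) ek.
  by move: d0; rewrite -ek => d0; rewrite d0 ltxx in out1.
have n3 : \forall e \near (0 : R)^'+, 0 < e by exact: nbhs_right_gt.
have [e [[e1 e2] e0]] := filter_ex (filterI (filterI n1 n2) n3).
exists e => //; rewrite near_singularE => -[[[[i' j'] b] _ [/= hb]]|].
  move=> [h' [t [q [ht hq]]]]; rewrite ltNge => /negP; apply.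
  have E := itin_det h' h.
  have e0' : i' = i := E 0%N isT.
  have e1' : j' = j := E 1%N isT.
  subst i' j'; case/andP: ht => t0 t1.
  have d0 : 0 < htime c 1 z by [].
  have := e1 (t / htime c 1 z) (direction i b z) q.
  rewrite [htime c 0 z]/= subr0 add0r divfK ?gt_eqF //; apply => //.
    by rewrite divr_ge0 ?(ltW d0) //= ler_pdivrMr // mul1r ltW.
  exact: unit_vec_direction.
move=> [tau' [z'' [hs' [[j' b] _ [/= hb [k1 k2 [q hq]]]]]]].
rewrite ltNge => /negP; apply.
have [i'' [j'' [h' ez _]]] := (stepP Q _ _ _).1 hs'.
have E := itin_det h' h.
have e0' : i'' = i := E 0%N isT.
have e1' : j'' = j := E 1%N isT.
subst i'' j'' z''.
have ej : j' = j := in_open_side_uniq k1 (in_open_sideW (coords_in_open_side h)).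
subst j'.
have -> : arc_point j (coords (two_sides i j) 1 z).1 = line c 1 z (htime c 1 z) := coords_arc h.
have := e2 0 (direction j b (coords (two_sides i j) 1 z)) q.
rewrite subrr mulr0 addr0; apply => //; first by rewrite lexx ler01.
by rewrite unit_vec_direction; exact: (coords_angle h).2.
Qed.

Lemma near_singularW (a b : R) : a <= b -> near_singular Q a `<=` near_singular Q b.
Proof.
move=> ab z [hz [t [q [q' [h1 h2 h3]]]]]; split=> //; exists t, q, q'; split=> //.
exact: lt_le_trans ab.
Qed.

End Gap.

(** * Finite measures *)

Section FiniteMeasure.
Context d (T : measurableType d) (R : realType) (mu : {finite_measure set T -> \bar R}).
Implicit Types (F E : nat -> set T) (b eta : R).

Lemma measure_lt_of_empty F eta : (forall n, measurable (F n)) ->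
  (forall m n, (m <= n)%N -> F n `<=` F m) -> \bigcap_n F n = set0 -> 0 < eta ->
  exists n, (mu (F n) < eta%:E)%E.
Proof.
move=> mF dF F0 eta0.
have h : (mu \o F) n @[n --> \oo] --> mu (\bigcap_n F n).
  apply: nonincreasing_cvg_mu => //.
  - by rewrite ltey_eq fin_num_measure.
  - by rewrite F0.
  - by move=> n m nm; apply/subsetPset; exact: dF.
rewrite F0 measure0 in h.
have : \forall n \near \oo, (mu (F n) < eta%:E)%E.
  apply: (h [set x | (x < eta%:E)%E]).
  apply: open_nbhs_nbhs; split; last by rewrite /= lte_fin.
  exact: open_ereal_lt_ereal.
by case=> N _ /(_ N (leqnn N)) hN; exists N.
Qed.

Lemma negligible_bigcup_count (J : countType) (F : J -> set T) :
  (forall i, mu.-negligible (F i)) -> mu.-negligible (\bigcup_i F i).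
Proof.
move=> negF; have : mu.-negligible (\bigcup_n oapp F set0 (unpickle n)).
  apply: negligible_bigcup => n; case: unpickle => [i|] /=; first exact: negF.
  exact: negligible_set0.
apply: negligibleS => x [i _ Fx]; exists (pickle i); first exact: I.
by rewrite pickleK.
Qed.

Lemma union_bound F b (n : nat) :
  (forall k, measurable (F k)) -> (forall k, (mu (F k) <= b%:E)%E) ->
  exists M, [/\ measurable M, (mu M <= (n%:R * b)%:E)%E &
    forall k, (k < n)%N -> F k `<=` M].
Proof.
move=> mF hF; elim: n => [|n [M [mM hM sM]]].
  by exists set0; split=> //; rewrite measure0 mul0r.
exists (M `|` F n); split; first exact: measurableU.
  apply: (le_trans (measureU2 _ mM (mF n))).
  by rewrite -natr1 mulrDl mul1r EFinD; exact: leeD hM (hF n).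
move=> k; rewrite ltnS leq_eqVlt => /orP[/eqP ->|kn]; first exact: subsetUr.
by apply: (subset_trans (sM k kn)); exact: subsetUl.
Qed.

(** Markov's inequality for the number of the sets [E 0], ..., [E (2 h - 1)] that
contain a point: its integral is at most [2 * h * b]. *)
Lemma count_markov E b (h : nat) : (0 < h)%N ->
  (forall k, measurable (E k)) -> (forall k, (mu (E k) <= b%:E)%E) ->
  exists M, [/\ measurable M, (mu M <= (2 * b)%:E)%E &
    forall x, ~ M x -> \sum_(k < 2 * h) \1_(E k) x < h%:R :> R].
Proof.
move=> h0 mE hE.
pose f x : R := \sum_(k < 2 * h) \1_(E k) x.
have mf : measurable_fun setT f.
  by apply: measurable_sum => k; exact: measurable_indic.
pose M := [set x | h%:R <= f x].
have mM : measurable M.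
  rewrite [M](_ : _ = setT `&` f @^-1` `[h%:R, +oo[%classic).
    by apply: mf => //; exact: measurable_itv.
  by rewrite setTI; apply/seteqP; split=> x; rewrite /M /= in_itv /= andbT.
exists M; split=> //; last by move=> x /negP; rewrite -ltNge.
have f0 x : 0 <= f x by apply: sumr_ge0 => k _.
have hp : 0 < h%:R :> R by rewrite ltr0n.
have H : (h%:R%:E * mu M <= (h%:R * (2 * b))%:E)%E.
  have -> : (h%:R%:E * mu M = \int[mu]_x (h%:R%:E * (\1_M x)%:E))%E.
    rewrite ge0_integralZl_EFin //; last first.
      by apply/measurable_EFinP; exact: measurable_indic.
    by rewrite integral_indic // setIT.
  apply: (@le_trans _ _ (\int[mu]_x (f x)%:E)%E).
    apply: ge0_le_integral => //.
    - apply/measurable_EFinP; apply: measurable_funM => //.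
    - by apply/measurable_EFinP.
    - move=> x _; rewrite -EFinM lee_fin indicE.
      by have [/set_mem|_] := boolP (x \in M); rewrite ?mulr1 ?mulr0.
  have -> : (\int[mu]_x (f x)%:E = \sum_(k < 2 * h) mu (E k))%E.
    transitivity (\int[mu]_x (\sum_(k < 2 * h) (\1_(E k) x)%:E)%E)%E.
      by apply: eq_integral => x _; rewrite -sumEFin.
    rewrite ge0_integral_sum //; last first.
      by move=> k; apply/measurable_EFinP; exact: measurable_indic.
    by apply: eq_bigr => k _; rewrite integral_indic // setIT.
  apply: (@le_trans _ _ (\sum_(k < 2 * h) b%:E)%E); first by apply: lee_sum.
  rewrite sumEFin lee_fin sumr_const card_ord -(mulr_natl b) natrM.
  by rewrite mulrCA mulrA.
have fM : mu M \is a fin_num by rewrite fin_num_measure.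
move: H; rewrite -(fineK fM) -EFinM !lee_fin => H.
by move: H; rewrite ler_pM2l.
Qed.

End FiniteMeasure.

(** * Measure of the exceptional sets *)

Section InvariantMeasure.
Context (R : realType) (Q : polygon R).
Context (nu : {finite_measure set (measurableTypeR R * measurableTypeR R)%type -> \bar R}).
Context (hnu : billiard_invariant Q nu).
Implicit Types (z : R * R) (A : set (R * R)) (k m n : nat).
Implicit Types (c : nat -> 'I_(nsides Q)) (v : 'I_(nsides Q)).
Let mR := measurableTypeR R.

Definition iter_preimage k A : set (R * R) := iter k (@step_preimage R Q) A.

Lemma measurable_iter_preimage k A : measurable (A : set (mR * mR)) ->
  measurable (iter_preimage k A : set (mR * mR)).
Proof. by move=> mA; elim: k => // k IH; exact: measurable_step_preimage. Qed.

Lemma measure_iter_preimage k A : measurable (A : set (mR * mR)) -> nu (iter_preimage k A) = nu A.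
Proof.
move=> mA; elim: k => // k <-.
exact: (hnu.2 _ (measurable_iter_preimage k mA)).
Qed.

Lemma billiard_iter_preimage k z y A : billiard_iter Q k z y -> A y -> iter_preimage k A z.
Proof.
elim: k y A => [|k IH] y A; first by move=> [_ ->].
move=> [y' hy' [tau hs]] Ay; rewrite /iter_preimage iterSr.
by apply: (IH y') => //; exists tau, y.
Qed.

Lemma nonsingular_phase_space : nonsingular Q `<=` @phase_space R Q.
Proof. by move=> z /(_ 0%N) [y []]. Qed.

Lemma nonsingular_itin z n : nonsingular Q z -> exists c, itin c n z.
Proof.
move=> /(_ n.+1) [y /itin_of_billiard_iter[c hc _]]; exists c; exact: itinW hc.
Qed.

(** A vertex at distance less than [a] carries a singular vector with the same
direction as the flight, so that only the feet contribute to [rho]. *)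
Lemma not_near_singular_far c k z (a : R) : itin c k.+1 z ->
  ~ near_singular Q a (coords c k z) ->
  forall t v, htime c k z <= t <= htime c k.+1 z ->
    a <= enorm (line c k z t - vertex v).
Proof.
move=> h ns t v /andP[t0 t1]; rewrite leNgt; apply/negP => lt; apply: ns.
have hk := itinW (leqnSn k) h.
split; first exact: coords_phase_space.
have [psi hpsi e] := angle_exists (unfold_dirU c k z).
have [psi' hpsi' e'] := angle_exists (unfold_dirU c k.+1 z).
have rhoE (x : R * R) (s : R) : rho (x, s) (vertex v, s) = enorm (x - vertex v).
  by rewrite /rho /= subrr normr0 addr0.
have [tlt|tge] := ltP t (htime c k.+1 z).
  exists (t - htime c k z), (line c k z t, psi), (vertex v, psi); split.
  - exists (htime c k.+1 z - htime c k z), (coords c k.+1 z),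
      (line c k z (htime c k z), psi); split.
    + exact: itin_step.
    + exact: coords_vector_at.
    + by left; rewrite subr_ge0 t0 ltrD2r tlt /= -e -lineB.
  - by split=> //; left; exists v.
  - by rewrite rhoE.
exists (htime c k.+1 z - htime c k z), (line c k.+1 z (htime c k.+1 z), psi'),
  (vertex v, psi'); split.
- exists (htime c k.+1 z - htime c k z), (coords c k.+1 z),
    (line c k z (htime c k z), psi); split.
  + exact: itin_step.
  + exact: coords_vector_at.
  + by right; split=> //; exact: coords_vector_at.
- by split=> //; left; exists v.
- rewrite rhoE line_hit; last first.
    by case: h => _ _ /(_ _ (ltnSn k)) [_ + _ _]; rewrite lt_neqAle => /andP[].
  suff -> : htime c k.+1 z = t by [].
  by apply/le_anti; rewrite tge.
Qed.

Lemma natSinv_lt (e : R) : 0 < e -> exists n : nat, n.+1%:R^-1 < e.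
Proof.
move=> e0; have [N _ hN] := near_infty_natSinv_lt (PosNum e0).
by exists N; exact: (hN N (leqnn N)).
Qed.

Lemma natSinv_le (m n : nat) : (m <= n)%N -> n.+1%:R^-1 <= m.+1%:R^-1 :> R.
Proof. by move=> mn; rewrite lef_pV2 ?posrE ?ltr0n // ler_nat ltnS. Qed.

(** The sets of short flights decrease to the empty set, since every flight has
positive length. *)
Lemma short_flight_small (eta : R) : 0 < eta ->
  exists2 delta : R, 0 < delta & (nu (short_flight Q delta) < eta%:E)%E.
Proof.
move=> eta0.
have [||||n hn] := @measure_lt_of_empty _ _ _ nu (fun n => short_flight Q n.+1%:R^-1) eta.
- by move=> n; apply: open_measurable_plane; exact: open_short_flight.
- move=> m n mn z [tau [z' [hs lt]]]; exists tau, z'; split=> //.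
  exact: (lt_le_trans lt (natSinv_le mn)).
- apply/seteqP; split=> // z hz.
  have [tau [z' [hs _]]] := hz 0%N I.
  have [_ _ tau0 _] := hs.
  have [n hn] := natSinv_lt tau0.
  have [tau' [z'' [hs' lt]]] := hz n I.
  have [i [j [h _ e]]] := (stepP Q _ _ _).1 hs.
  have [i' [j' [h' _ e']]] := (stepP Q _ _ _).1 hs'.
  have E := itin_det h h'; rewrite -(htime_ext z E) -e in e'.
  by move: hn; rewrite -e' ltNge ltW.
- by [].
- by exists n.+1%:R^-1; rewrite ?invr_gt0 ?ltr0n.
Qed.

Lemma near_singular_small (eta : \bar R) : (0 < eta)%E ->
  exists2 a : R, 0 < a & (nu (near_singular Q a) < eta)%E.
Proof.
have H (r : R) : 0 < r -> exists2 a : R, 0 < a & (nu (near_singular Q a) < r%:E)%E.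
  move=> r0.
  have [||||n hn] := @measure_lt_of_empty _ _ _ nu
    (fun n => near_singular Q n.+1%:R^-1) r.
  - by move=> n; exact: measurable_near_singular.
  - by move=> m n mn; apply: near_singularW; exact: natSinv_le.
  - apply/seteqP; split=> // z hz.
    have [e e0 ne] := near_singular_vanish Q z.
    have [n hn] := natSinv_lt e0.
    by apply: ne; apply: (near_singularW (ltW hn)); exact: hz.
  - by [].
  - by exists n.+1%:R^-1; rewrite ?invr_gt0 ?ltr0n.
case: eta => [r| |] //; first by rewrite lte_fin; exact: H.
move=> _; have [a a0 ha] := H 1 ltr01; exists a => //.
by apply: (lt_trans ha); rewrite ltry.
Qed.

Lemma bound_gt0 (K0 : R) (n fn : nat) : 0 < K0 -> (0 < n)%N ->
  (0 < K0%:E / ((n * fn)%:R)%:E :> \bar R)%E.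
Proof.
move=> K00 n0; rewrite inver; case: ifP => [_|/negbT h].
  by rewrite gt0_muley ?lte_fin // ltry.
rewrite -EFinM lte_fin mulr_gt0 // invr_gt0 lt_neqAle eq_sym h.
by rewrite ler0n.
Qed.

Lemma admissible_exists (f : nat -> nat) (K0 : R) : 0 < K0 ->
  exists a, admissible Q nu f K0 a.
Proof.
move=> K00.
have H n : exists b : R, 0 < b /\ ((0 < n)%N ->
    (nu (near_singular Q b) < K0%:E / ((n * f n)%:R)%:E)%E).
  case: n => [|n]; first by exists 1.
  have [b b0 hb] := near_singular_small (bound_gt0 (f n.+1) K00 (ltn0Sn n)).
  by exists b.
have [b hb] := choice H.
(* Running minima make the sequence non-increasing. *)
pose a := fix a n : R := if n is m.+1 then Num.min (a m) (b n) else b 0%N.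
have a_gt0 n : 0 < a n.
  by elim: n => [|n IH] /=; [case: (hb 0%N)|rewrite lt_min IH; case: (hb n.+1)].
have aS n : a n.+1 <= a n by rewrite /= ge_min lexx.
have ab n : a n <= b n by case: n => [|n] //=; rewrite ge_min lexx orbT.
exists a; split=> //.
  move=> m n /andP[_]; elim: n => [|n IH]; first by rewrite leqn0 => /eqP ->.
  rewrite leq_eqVlt => /orP[/eqP -> //|]; rewrite ltnS => /IH.
  exact: le_trans.
move=> n n0; apply: (le_lt_trans _ ((hb n).2 n0)).
apply: le_measure; rewrite ?inE; [exact: measurable_near_singular| |].
  exact: measurable_near_singular.
exact: near_singularW.
Qed.

(** The itinerary is followed beyond time [T], for as many flights as needed. *)
Definition stays_clear (a T : R) z := exists c m,
  [/\ itin c m z, T < htime c m z & far_from_vertices a T c m z].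

(** The number [2 * g * n] of flights is chosen so that at least half of them,
each longer than [delta], cover the time [1 + n * diam Q]. It is a fixed multiple
of [n], so that the measure of the visits to the singular neighbourhood is at most a
constant divided by [f n]. *)
Lemma measure_not_clear_small (a : nat -> R) (f : nat -> nat) (K0 eta : R) :
  (forall M, exists N, forall n, (N <= n)%N -> (M <= f n)%N) ->
  0 < K0 -> admissible Q nu f K0 a -> 0 < eta ->
  exists N, forall n, (N <= n)%N -> exists M,
    [/\ measurable (M : set (mR * mR)), (nu M <= eta%:E)%E &
      forall z, nonsingular Q z -> ~ M z -> stays_clear (a n) (1 + n%:R * diam Q) z].
Proof.
move=> fty K00 [a_gt0 a_mono a_small] eta0.
have eta4 : 0 < eta / 4 by rewrite divr_gt0.
have [delta delta0 hdelta] := short_flight_small eta4.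
have [g hg] : exists g : nat, (1 + diam Q) / delta < g%:R.
  by exists (Num.bound ((1 + diam Q) / delta)); apply: archi_boundP;
     rewrite divr_ge0 ?(ltW delta0) // addr_ge0 // ltW // diam_gt0.
have D0 := diam_gt0 Q.
have g0 : 0 < g%:R :> R.
  by apply: lt_trans hg; rewrite divr_gt0 // addr_gt0.
have [F hF] : exists F : nat, 4 * g%:R * K0 / eta < F%:R.
  exists (Num.bound (4 * g%:R * K0 / eta)); apply: archi_boundP.
  by rewrite divr_ge0 ?(ltW eta0) // !mulr_ge0 // ltW.
have [N hN] := fty F.
exists (maxn N 1) => n; rewrite geq_max => /andP[Nn n0].
have fF : F%:R <= (f n)%:R :> R by rewrite ler_nat; exact: hN.
have n0R : 0 < n%:R :> R by rewrite ltr0n.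
have f0 : 0 < (f n)%:R :> R.
  by apply: lt_le_trans fF; apply: le_lt_trans hF; rewrite divr_ge0 ?(ltW eta0) // !mulr_ge0 // ltW.
pose h := (g * n)%N.
have h0 : (0 < h)%N by rewrite muln_gt0 n0 andbT -(ltr0n R).
have mS : measurable (short_flight Q delta : set (mR * mR)).
  by apply: open_measurable_plane; exact: open_short_flight.
have mN : measurable (near_singular Q (a n) : set (mR * mR)).
  exact: measurable_near_singular.
have nuN k : (nu (iter_preimage k (near_singular Q (a n))) <= (K0 / (n%:R * (f n)%:R))%:E)%E.
  rewrite measure_iter_preimage //; apply: ltW; have := a_small n n0.
  by rewrite inver natrM gt_eqF ?mulr_gt0 // -EFinM.
have nuS k : (nu (iter_preimage k (short_flight Q delta)) <= (eta / 4)%:E)%E.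
  by rewrite measure_iter_preimage // ltW.
have [M1 [mM1 nuM1 sM1]] := union_bound (2 * h) (fun k => measurable_iter_preimage k mN) nuN.
have [M2 [mM2 nuM2 sM2]] := count_markov h0 (fun k => measurable_iter_preimage k mS) nuS.
exists (M1 `|` M2); split; first exact: measurableU.
  apply: (le_trans (measureU2 _ mM1 mM2)).
  apply: (le_trans (leeD nuM1 nuM2)).
  rewrite -EFinD lee_fin !natrM.
  have -> : 2 * (g%:R * n%:R) * (K0 / (n%:R * (f n)%:R)) = 2 * g%:R * K0 / (f n)%:R :> R.
    by field; rewrite ?gt_eqF.
  have : 2 * g%:R * K0 / (f n)%:R <= eta / 2.
    rewrite ler_pdivrMr //; move: hF; rewrite ltr_pdivrMr // => hF.
    have := ler_wpM2r (ltW eta0) fF; lra.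
  by lra.
move=> z hz /not_orP[nM1 nM2].
have [c hc] := nonsingular_itin (2 * h) hz.
exists c, (2 * h)%N; split=> //; last first.
  move=> k t v kh tk tT; apply: not_near_singular_far tk; first exact: itinW hc.
  move=> ns; apply: nM1; apply: (sM1 k kh).
  apply: billiard_iter_preimage ns; apply: (itin_iter hc); exact: ltnW.
have cnt := sM2 z nM2.
have tm m : (m <= 2 * h)%N -> delta * (m%:R -
    \sum_(k < m) \1_(iter_preimage k (short_flight Q delta)) z) <= htime c m z.
  elim: m => [|m IH] mh; first by rewrite big_ord0 subrr mulr0.
  have {}IH := IH (ltnW mh).
  have hm := itinW mh hc.
  have T := htime_lt hm.
  rewrite big_ord_recr /= -/(htime c m.+1 z) -natr1 indicE.
  have [_|/negP nin] := boolP (z \in _).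
    by apply: (le_trans _ (ltW T)); apply: (le_trans _ IH); rewrite ler_pM2l //= ; lra.
  have : delta <= htime c m.+1 z - htime c m z.
    rewrite leNgt; apply/negP => lt; apply: nin; rewrite inE.
    apply: (billiard_iter_preimage (y := coords c m z)); first by apply: (itin_iter hm); exact: leqnSn.
    by exists (htime c m.+1 z - htime c m z), (coords c m.+1 z); split=> //; exact: itin_step.
  by rewrite /=; nra.
apply: lt_le_trans (tm (2 * h)%N (leqnn _)).
have h1 : delta * h%:R <= delta * ((2 * h)%:R -
    \sum_(k < 2 * h) \1_(iter_preimage k (short_flight Q delta)) z).
  by rewrite ler_pM2l // natrM; lra.
apply: (lt_le_trans _ h1); rewrite natrM mulrA.
move: hg; rewrite ltr_pdivrMr // => hg.
have h2 : (1 + diam Q) * n%:R < g%:R * delta * n%:R by rewrite ltr_pM2r.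
have n1 : 1 <= n%:R :> R by rewrite ler1n.
by lra.
Qed.

End InvariantMeasure.

(** * The set of full measure *)

Section FullMeasureSet.
Context (R : realType) (Q : polygon R).
Implicit Types (z y : R * R) (n : nat) (c : nat -> 'I_(nsides Q)).

Definition dist1 z y : R := `|z.1 - y.1| + `|z.2 - y.2|.

Lemma dist1_triangle x y z : dist1 x z <= dist1 x y + dist1 y z.
Proof.
rewrite /dist1; have := ler_distD y.1 x.1 z.1; have := ler_distD y.2 x.2 z.2; lra.
Qed.

Lemma dist1xx z : dist1 z z = 0.
Proof. by rewrite /dist1 !subrr normr0 addr0. Qed.

(** A vertex being at distance at least [a] from the foot of [z], the whole ball is
launched from the same side. The condition on [z.2] keeps the ball away from the
tangent vectors; for a given [z] it holds as soon as [n] is large. *)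
Lemma stays_clear_ball (a : R) n z : 0 < a -> stays_clear Q a (1 + n%:R * diam Q) z ->
  a / (1 + n%:R * diam Q) <= z.2 <= pi - a / (1 + n%:R * diam Q) ->
  exists c, forall y, dist1 z y < a / (1 + n%:R * diam Q) -> itin c n y.
Proof.
set T := 1 + _; move=> a0 [c [m [hc hT far]]] /andP[m1 m2].
have T1 : 1 <= T by rewrite lerDl mulr_ge0 // ltW // diam_gt0.
have T0 : 0 < T by apply: lt_le_trans T1.
have m0 : (0 < m)%N by case: m hT {hc far} => //=; rewrite ltNge (ltW T0).
have hc1 := itinW m0 hc; have h01 := htime_lt hc1.
have [/andP[i0 i1] _ _] := hc.
have far0 (v : 'I_(nsides Q)) : a <= enorm (line c 0 z 0 - vertex v).
  by apply: far => //; [rewrite lexx (ltW h01)|rewrite ltW].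
have dU := side_dirU (c 0%N).
have d1 : a <= z.1 - side_start (c 0%N).
  have := far0 (c 0%N); rewrite /line /= scale0r addr0 /arc_point addrAC subrr add0r.
  by rewrite (enormZ (z.1 - _)) (enorm1P dU) mulr1 gtr0_norm // subr_gt0.
have d2 : a <= side_start (c 0%N) + side_len (c 0%N) - z.1.
  have := far0 (ordS (c 0%N)); rewrite /line /= scale0r addr0 /arc_point.
  have -> : vertex (ordS (c 0%N)) = vertex (c 0%N) + side_len (c 0%N) *: side_dir (c 0%N).
    by rewrite -side_lenE addrC subrK.
  rewrite opprD addrACA subrr add0r -scalerBl (enormZ (_ - _)) (enorm1P dU) mulr1.
  rewrite ltr0_norm; lra.
exists c => y; rewrite /dist1 ltr_pdivlMr // => hy.
have hy1 : `|z.1 - y.1| + `|z.2 - y.2| < a / T by rewrite ltr_pdivlMr.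
have aT : a / T <= a by rewrite ler_pdivrMr // ler_peMr // ltW.
have n1 := normr_ge0 (z.1 - y.1); have n2 := normr_ge0 (z.2 - y.2).
have [k1 k2] : `|z.1 - y.1| < a /\ `|z.2 - y.2| < a / T by split; lra.
move: k1 k2; rewrite !ltr_norml => /andP[k1 k1'] /andP[k2 k2'].
apply: (same_itinerary hc hT far).
- by apply/andP; split; lra.
- by apply/andP; split; lra.
- rewrite distrC (distrC y.2); apply: le_lt_trans hy.
  by rewrite -/T [leRHS]mulrDl [T * _]mulrC lerD2r ler_peMr.
Qed.

(** An open set of centres, built from balls with a common itinerary. The margin
leaves room for the ball of radius [a n / (2 + n * diam Q)] around [y] inside the
ball around [z]. *)
Definition itin_ball (a : nat -> R) n : set (R * R) := [set y | (0 < n)%N /\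
  exists z c, (forall x, dist1 z x < a n / (1 + n%:R * diam Q) -> itin c n x) /\
    dist1 z y < a n / (1 + n%:R * diam Q) - a n / (2 + n%:R * diam Q)].

Lemma open_itin_ball a n : open (itin_ball a n).
Proof.
rewrite openE => y [n0 [z [c [hz lt]]]]; apply/nbhs_ballP.
set r := _ - _ in lt; exists ((r - dist1 z y) / 2) => /=.
  by rewrite divr_gt0 // subr_gt0.
move=> x [h1 h2]; split=> //; exists z, c; split=> //.
apply: (le_lt_trans (dist1_triangle z y x)).
have yx : dist1 y x < r - dist1 z y.
  by move: h1 h2; rewrite /ball /=; set D := dist1 z y; rewrite /dist1; lra.
by rewrite -/r; lra.
Qed.

Lemma itin_ball_cell a n y : itin_ball a n y ->
  phase_ball Q y (a n / (2 + n%:R * diam Q)) `<=` cell Q n y.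
Proof.
move=> [n0 [z [c [hz lt]]]] x [hx hxy].
set r1 := a n / (1 + _) in hz lt; set r2 := a n / (2 + _) in lt hxy.
have r2_gt0 : 0 < r2 by apply: le_lt_trans hxy; rewrite addr_ge0.
have iy : itin c n y by apply: hz; lra.
have ix : itin c n x.
  apply: hz; apply: (le_lt_trans (dist1_triangle z y x)).
  by move: hxy; rewrite -/(dist1 y x); lra.
move=> k kn; exists (coords c k y), (coords c k x), (c k); split.
- exact: itin_iter iy _ kn.
- exact: itin_iter ix _ kn.
- exact: coords_in_open_side (itinW kn iy).
- exact: coords_in_open_side (itinW kn ix).
Qed.

Lemma stays_clear_itin_ball a n z : (0 < n)%N -> 0 < a n ->
  stays_clear Q (a n) (1 + n%:R * diam Q) z ->
  a n / (1 + n%:R * diam Q) <= z.2 <= pi - a n / (1 + n%:R * diam Q) ->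
  itin_ball a n z.
Proof.
move=> n0 an0 gz hz; have [c hc] := stays_clear_ball an0 gz hz.
split=> //; exists z, c; split=> //; rewrite dist1xx subr_gt0.
have nD : 0 <= n%:R * diam Q by rewrite mulr_ge0 // ltW // diam_gt0.
have p1 : 0 < 1 + n%:R * diam Q by lra.
have p2 : 0 < 2 + n%:R * diam Q by lra.
by rewrite ltr_pM2l // ltf_pV2 ?posrE //; lra.
Qed.

Lemma increasing_selection (P : nat -> Prop) :
  (forall N, exists2 n, (N <= n)%N & P n) ->
  exists ni : nat -> nat, {homo ni : i j / (i < j)%N} /\ forall i, P (ni i).
Proof.
move=> H; have H' N : exists n, (N <= n)%N /\ P n by have [n] := H N; exists n.
have [s hs] := choice H'.
pose ni := fix ni i := if i is k.+1 then s (ni k).+1 else s 0%N.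
exists ni; split; last by case=> [|i]; [exact: (hs 0%N).2|exact: (hs (ni i).+1).2].
apply: homo_ltn; first by move=> y x z; exact: ltn_trans.
by move=> i; exact: (hs (ni i).+1).1.
Qed.

Lemma f_eventually_large (f : nat -> nat) :
  (forall m n, (0 < m <= n)%N -> (f m <= f n)%N) ->
  (forall M, exists n, (M <= f n)%N) ->
  forall M, exists N, forall n, (N <= n)%N -> (M <= f n)%N.
Proof.
move=> fm fu M; have [N hN] := fu (maxn M (f 0%N).+1).
move: hN; rewrite geq_max => /andP[h1 h2].
exists N => n Nn; apply: (leq_trans h1); apply: fm; rewrite Nn andbT.
by case: N h2 {h1 Nn} => //; rewrite ltnn.
Qed.

Section Support.
Context (nu : {finite_measure set (measurableTypeR R * measurableTypeR R)%type -> \bar R}).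
Context (hnu : billiard_invariant Q nu).
Let mR := measurableTypeR R.

(** The points with a null neighbourhood are covered by the null boxes with
rational end points. *)
Lemma negligible_off_supp : nu.-negligible (~` supp Q nu).
Proof.
pose F (q : rat * rat * rat * rat) : set (R * R) :=
  if `[< nu (rat_box q) = 0%E >] then rat_box q else set0.
have negF : nu.-negligible (\bigcup_q F q).
  apply: negligible_bigcup_count => q; rewrite /F.
  case: asboolP => // h; last exact: negligible_set0.
  by exists (rat_box q); split=> //; exact: measurable_rat_box.
have : nu.-negligible (~` nonsingular Q `|` \bigcup_q F q).
  by apply: negligibleU => //; exact: hnu.1.
apply: negligibleS => z nz; have [hz|] := pselect (nonsingular Q z); [right|by left].
have [U oU [Uz nU]] : exists2 U : set (R * R), open U & U z /\ ~ (0 < nu U)%E.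
  apply: contrapT => H; apply: nz; split; first exact: nonsingular_phase_space.
  move=> U oU Uz; apply: contrapT => nU; apply: H; exists U => //.
have [q [qz qU]] := rat_box_nbhs (open_nbhs_nbhs (conj oU Uz)).
exists q => //; rewrite /F; case: asboolP => // nq; case: nq.
apply/eqP; rewrite -measure_le0; apply: (@le_trans _ _ (nu U)).
  apply: le_measure; rewrite ?inE //; first exact: measurable_rat_box.
  exact: open_measurable_plane.
by rewrite leNgt; exact/negP.
Qed.

(** The vectors [z] with [z.2] in a compact interval [W q] of angles are treated
one interval at a time: on it, the condition of [stays_clear_itin_ball] on [z.2]
holds for all large [n]. The vectors of [W q] that are in no [itin_ball] from [N] on
form a set whose measure is below any [e > 0], because arbitrarily large [n] have an
exceptional set of measure at most [e]. *)
Lemma full_measure_limsup (a : nat -> R) (f : nat -> nat) (K0 : R) :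
  (forall M, exists N, forall n, (N <= n)%N -> (M <= f n)%N) ->
  0 < K0 -> admissible Q nu f K0 a ->
  nu.-negligible (~` \bigcap_N \bigcup_(n in [set n | (N <= n)%N]) itin_ball a n).
Proof.
move=> fty K00 adm; have [a_gt0 a_mono _] := adm.
have [Z [mZ nuZ sZ]] := hnu.1.
pose W (q : nat) : set (R * R) := setT `*` `[q.+1%:R^-1, pi - q.+1%:R^-1]%classic.
have mW q : measurable (W q : set (mR * mR)).
  by apply: measurableX; [exact: measurableT|exact: measurable_itv].
pose V (N : nat) : set (R * R) :=
  ~` \bigcup_(n in [set n | (N <= n)%N]) itin_ball a n.
have mV N : measurable (V N : set (mR * mR)).
  apply: measurableC; apply: open_measurable_plane; apply: bigcup_open => n _.
  exact: open_itin_ball.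
have null N q : nu (V N `&` W q) = 0%E.
  apply/eqP; rewrite -measure_le0; apply/lee_addgt0Pr => e e0; rewrite add0e.
  have [N1 hN1] := measure_not_clear_small hnu fty K00 adm e0.
  have q0 : 0 < q.+1%:R^-1 :> R by rewrite invr_gt0 ltr0n.
  have [N2 hN2] : exists N2 : nat, a 1%N / (q.+1%:R^-1 * diam Q) < N2%:R.
    exists (Num.bound (a 1%N / (q.+1%:R^-1 * diam Q))); apply: archi_boundP.
    by rewrite divr_ge0 // ?mulr_ge0 ?(ltW (diam_gt0 Q)) // ltW // a_gt0.
  have [n [Nn N1n N2n n0]] : exists n, [/\ (N <= n)%N, (N1 <= n)%N, (N2 <= n)%N & (0 < n)%N].
    by exists (maxn (maxn N N1) (maxn N2 1)); split; rewrite !leq_max leqnn ?orbT.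
  have [M [mM nuM sM]] := hN1 n N1n.
  have an0 := a_gt0 n n0.
  have r1 : a n / (1 + n%:R * diam Q) <= q.+1%:R^-1.
    have D0 := diam_gt0 Q.
    have nD : 0 <= n%:R * diam Q by rewrite mulr_ge0 // ltW.
    have p1 : 0 < 1 + n%:R * diam Q by lra.
    have a1 : a n <= a 1%N by apply: a_mono; rewrite n0.
    rewrite ler_pdivrMr //; apply: (le_trans a1).
    move: hN2; rewrite ltr_pdivrMr ?mulr_gt0 // => hN2.
    have Nn2 : N2%:R <= n%:R :> R by rewrite ler_nat.
    have h : N2%:R * (q.+1%:R^-1 * diam Q) <= n%:R * (q.+1%:R^-1 * diam Q).
      by rewrite ler_wpM2r // mulr_ge0 // ltW.
    rewrite mulrDr mulr1 [_^-1 * (n%:R * _)]mulrCA.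
    by apply: (le_trans (ltW hN2)); apply: (le_trans h); rewrite lerDr ltW.
  apply: (@le_trans _ _ (nu (M `|` Z))).
    apply: le_measure; rewrite ?inE; [exact: measurableI|exact: measurableU|].
    move=> z [Vz [_ /=]]; rewrite in_itv /= => /andP[w1 w2].
    have [hz|hz] := pselect (nonsingular Q z); [left|right; exact: sZ].
    apply: contrapT => nMz; apply: Vz; exists n => //.
    apply: stays_clear_itin_ball => //; first exact: sM.
    by rewrite (le_trans r1 w1) (le_trans w2) // lerB.
  apply: (le_trans (measureU2 _ mM mZ)).
  by rewrite [X in (_ + X)%E]nuZ adde0.
have : nu.-negligible (~` nonsingular Q `|` \bigcup_N \bigcup_q (V N `&` W q)).
  apply: negligibleU; first exact: hnu.1.
  apply: negligible_bigcup => N; apply: negligible_bigcup => q.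
  by exists (V N `&` W q); split; [exact: measurableI|exact: null|].
apply: negligibleS => z nz; have [hz|] := pselect (nonsingular Q z); [right|by left].
have [N VN] : exists N, V N z.
  by apply: contrapT => H; apply: nz => N _; apply: contrapT => nN; apply: H; exists N.
have [c [_ /andP[z0 z1] _]] := nonsingular_itin 0 hz.
have [q1 hq1] := natSinv_lt z0.
have z1' : 0 < pi - z.2 by rewrite subr_gt0.
have [q2 hq2] := natSinv_lt z1'.
exists N => //; exists (maxn q1 q2) => //; split=> //; split=> //=.
have h1 := @natSinv_le R _ _ (leq_maxl q1 q2).
have h2 := @natSinv_le R _ _ (leq_maxr q1 q2).
rewrite in_itv /= (le_trans h1 (ltW hq1)) /=.
by rewrite lerBrDl -lerBrDr (le_trans h2 (ltW hq2)).
Qed.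

End Support.

End FullMeasureSet.

Theorem theorem11 (R : realType) (Q : polygon R)
    (nu : {finite_measure set (measurableTypeR R * measurableTypeR R)%type
           -> \bar R})
    (hnu : billiard_invariant Q nu)
    (f : nat -> nat)
    (f_mono : forall m n, (0 < m <= n)%N -> (f m <= f n)%N)
    (f_unbounded : forall M, exists n, (M <= f n)%N)
    (K0 : R) (K0_gt0 : 0 < K0) :
  (exists a : nat -> R, admissible Q nu f K0 a) /\
  (forall a : nat -> R, admissible Q nu f K0 a ->
    exists G : set (R * R),
      [/\ nu.-negligible (~` G),
          exists2 U : set (R * R), Gdelta U & G = supp Q nu `&` U,
          supp Q nu `<=` closure G
        & forall z, G z -> exists ni : nat -> nat,
            {homo ni : i j / (i < j)%N} /\
            forall i, (0 < ni i)%N /\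
              phase_ball Q z (a (ni i) / (2 + (ni i)%:R * diam Q))
                `<=` cell Q (ni i) z]).
Proof.
have fty := f_eventually_large f_mono f_unbounded.
split=> [|a adm]; first exact: admissible_exists.
pose U := \bigcap_N \bigcup_(n in [set n | (N <= n)%N]) itin_ball Q a n.
have negG : nu.-negligible (~` (supp Q nu `&` U)).
  rewrite setCI; apply: negligibleU; first exact: negligible_off_supp.
  exact: full_measure_limsup fty K0_gt0 adm.
exists (supp Q nu `&` U); split=> //.
- exists U => //; exists (fun N => \bigcup_(n in [set n | (N <= n)%N]) itin_ball Q a n) => // N.
  by apply: bigcup_open => n _; exact: open_itin_ball.
- move=> z [_ hz] B Bz; apply: contrapT => nB.
  have [e /= e0 he] := (nbhs_ballP z B).1 Bz.
  have [A [mA nuA sA]] := negG.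
  have : (0 < nu (ball z e))%E.
    by apply: hz; [exact: ball_open|exact: ballxx].
  apply/negP; rewrite -leNgt -nuA; apply: le_measure; rewrite ?inE //.
    by apply: open_measurable_plane; exact: ball_open.
  move=> x hx; apply: sA => Gx; apply: nB; exists x; split=> //; exact: he.
- move=> z [_ Uz].
  have [|ni [hni Pni]] := @increasing_selection (fun n => itin_ball Q a n z).
    by move=> N; have [n Nn hn] := Uz N I; exists n.
  exists ni; split=> // i; split; first by case: (Pni i).
  exact: itin_ball_cell.
Qed.
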